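(* Let $C>\frac{4}{3^{3/2}}$ and $C^\ast\in\left(0,\left(C-\frac{4}{3^{3/2}}\right)^{-1/2}\right)$, and let $F:\mathbb{R}\to[\xi_{01},\xi_{02}]$, the metric $g_{C,C^\ast}$ on $\mathbb{R}^2$, the constants $c_k$ ($k\in\mathbb{Z}$) and the functions $\Phi^1,\Phi^2,\Phi^3,\Phi^4:\mathbb{R}\to\mathbb{R}$ be as defined in the context. Then the map $\Phi_{C,C^\ast}:(\mathbb{R}^2,g_{C,C^\ast})\to\mathbb{S}^3$ defined by $$\Phi_{C,C^\ast}(h,\theta)=\left(\Phi^1(h),\ \Phi^2(h),\ \Phi^3(h)\cos(\sqrt{C}\,\theta),\ \Phi^4(h)\sin(\sqrt{C}\,\theta)\right),\qquad (h,\theta)\in\mathbb{R}^2,$$ is a biconservative immersion.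
   Context: Biconservative immersions. Immersions of Riemannian surfaces are Riemannian (isometric) immersions; $\mathbb{S}^3\subset\mathbb{R}^4$ is the unit Euclidean sphere. For a Riemannian immersion of a surface in $\mathbb{S}^3$, let $A$ be the shape operator with respect to a (local) unit normal field and $f=\operatorname{trace}A$ the mean curvature function. The immersion is biconservative if the divergence of its stress-bienergy tensor vanishes, which for a surface in a 3-dimensional space form is equivalent to $A(\operatorname{grad}f)=-\frac{f}{2}\operatorname{grad}f$. The interval. Let $T(\xi)=-\xi^{8/3}+3C\xi^2-3$ for $\xi>0$. Since $C>\frac{4}{3^{3/2}}$, $T$ has exactly two positive zeros $0<\xi_{01}<\xi_{02}$, and $T>0$ on $(\xi_{01},\xi_{02})$. Put $\xi_{00}=\left(\frac94 C\right)^{3/2}\in(\xi_{01},\xi_{02})$. The function $F$. For $\xi\in(\xi_{01},\xi_{02})$ let $$h_0(\xi)=\int_{\xi_{00}}^{\xi}\sqrt{\frac{3\tau^2-(C^\ast)^2T(\tau)}{\tau^4T(\tau)}}\,d\tau .$$ This is strictly increasing with finite limits $h_{0,-1}=\lim_{\xi\searrow\xi_{01}}h_0(\xi)$ and $h_{0,1}=\lim_{\xi\nearrow\xi_{02}}h_0(\xi)$. For $k\in\mathbb{Z}\setminus\{0\}$ put $$h_{0,k}=\begin{cases}k\,h_{0,1}-(k-1)h_{0,-1},&k\ge1,\\ -k\,h_{0,-1}+(k+1)h_{0,1},&k\le-1,\end{cases}$$ and for $k\in\mathbb{Z}$ and $\xi\in(\xi_{01},\xi_{02})$ put $$h_k(\xi)=\begin{cases}k(h_{0,1}-h_{0,-1})+h_0(\xi),&k\text{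 even},\\ (k+1)h_{0,1}-(k-1)h_{0,-1}-h_0(\xi),&k\text{ odd}.\end{cases}$$ Then $h_k$ is a diffeomorphism from $(\xi_{01},\xi_{02})$ onto $(h_{0,k},h_{0,k+1})$ if $k\ge1$, onto $(h_{0,-1},h_{0,1})$ if $k=0$, and onto $(h_{0,k-1},h_{0,k})$ if $k\le-1$; let $\xi_k=\xi_k(h)$ denote its inverse. Define $F:\mathbb{R}\to\mathbb{R}$ by $F(h)=\xi_k(h)$ on each of these open intervals, and at their endpoints by: for $k\ge1$, $F(h_{0,k})=\xi_{02}$ if $k$ is odd and $\xi_{01}$ if $k$ is even; for $k\le-1$, $F(h_{0,k})=\xi_{01}$ if $k$ is odd and $\xi_{02}$ if $k$ is even. $F$ is at least of class $C^3$. The metric. On $\mathbb{R}^2$ with coordinates $(h,\theta)$, $$g_{C,C^\ast}(h,\theta)=\frac{3F^2(h)}{3F^2(h)-(C^\ast)^2\left(-F^{8/3}(h)+3CF^2(h)-3\right)}dh^2+\frac{1}{F^2(h)}d\theta^2 .$$ The functions $\Phi^i$. For $\xi\in(\xi_{01},\xi_{02})$ let $$\zeta_0(\xi)=\int_{\xi_{00}}^{\xi}\frac{\sqrt{C}\,\tau^{4/3}}{(-1+C\tau^2)\sqrt{-\tau^{8/3}+3C\tau^2-3}}\,d\tau ,$$ with finite limits $\zeta_{0,-1}=\lim_{\xi\searrow\xi_{01}}\zeta_0(\xi)$ and $\zeta_{0,1}=\lim_{\xi\nearrow\xi_{02}}\zeta_0(\xi)$; extend $\zeta_0$ to $[\xi_{01},\xi_{02}]$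 by these values. Let $c_0\in\mathbb{R}$, and let $c_k\in\mathbb{R}$, $k\in\mathbb{Z}$, be constants such that, modulo $2\pi$, $$c_k\equiv\begin{cases}k(\zeta_{0,1}-\zeta_{0,-1})+c_0,&k\text{ even},\\ (k-1)\zeta_{0,-1}-(k+1)\zeta_{0,1}-c_0,&k\text{ odd}.\end{cases}$$ For $\xi\in[\xi_{01},\xi_{02}]$ put $$\Phi^1_k(\xi)=\sqrt{1-\tfrac{1}{C\xi^2}}\cos(\zeta_0(\xi)+c_k),\qquad \Phi^2_k(\xi)=(-1)^k\sqrt{1-\tfrac{1}{C\xi^2}}\sin(\zeta_0(\xi)+c_k).$$ For $i\in\{1,2\}$ define $\Phi^i(h)=\Phi^i_k(F(h))$ for $h\in[h_{0,k},h_{0,k+1}]$ if $k\ge1$; $\Phi^i(h)=\Phi^i_0(F(h))$ for $h\in[h_{0,-1},h_{0,1}]$; and $\Phi^i(h)=\Phi^i_k(F(h))$ for $h\in[h_{0,k-1},h_{0,k}]$ if $k\le-1$. Finally $\Phi^3(h)=\Phi^4(h)=\frac{1}{\sqrt{C}\,F(h)}$ for $h\in\mathbb{R}$. *)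

(* Defs.v *)
From Stdlib Require Import Reals ZArith.
From Coquelicot Require Import Coquelicot.
Open Scope R_scope.

(** * Maps from (R^2, g) to the unit sphere S^3 of R^4

    Tensors on R^2 are given by their components in the global coordinates
    (h, theta). *)

Inductive coord : Set := ch | cth.

Inductive axis : Set := e1 | e2 | e3 | e4.

Definition sum2 (u : coord -> R) : R := u ch + u cth.

Definition sum4 (u : axis -> R) : R := u e1 + u e2 + u e3 + u e4.

Definition scalar_field := R -> R -> R.
Definition covector_field := coord -> scalar_field.
Definition bilinear_field := coord -> coord -> scalar_field.

(** Maps R^2 -> R^4, and vector fields in R^4 along such maps. *)
Definition field4 := axis -> scalar_field.

Definition pd (i : coord) (u : scalar_field) : scalar_field :=
  fun h t =>
    match i with
    | ch => Derive (fun x => u x t) h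
    | cth => Derive (fun y => u h y) t
    end.

Definition smooth (u : scalar_field) : Prop :=
  forall (n : nat) (h t : R), ex_diff_n u n h t.

Definition pd4 (i : coord) (V : field4) : field4 := fun a => pd i (V a).

Definition dot (V W : field4) : scalar_field :=
  fun h t => sum4 (fun a => V a h t * W a h t).

Definition riemannian_metric (g : bilinear_field) : Prop :=
  (forall i j, smooth (g i j)) /\
  (forall i j h t, g i j h t = g j i h t) /\
  (forall (h t : R) (v : coord -> R),
     (v ch <> 0 \/ v cth <> 0) ->
     0 < sum2 (fun i => sum2 (fun j => g i j h t * v i * v j))).

Definition det_metric (g : bilinear_field) : scalar_field :=
  fun h t => g ch ch h t * g cth cth h t - g ch cth h t * g cth ch h t.

(** Inverse of the 2x2 matrix (g_ij), by the adjugate formula. *)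
Definition inv_metric (g : bilinear_field) : bilinear_field :=
  fun i j h t =>
    match i, j with
    | ch, ch => g cth cth h t / det_metric g h t
    | ch, cth => - g ch cth h t / det_metric g h t
    | cth, ch => - g cth ch h t / det_metric g h t
    | cth, cth => g ch ch h t / det_metric g h t
    end.

(** [christoffel g k i j] is Gamma^k_{ij}. *)
Definition christoffel (g : bilinear_field) (k i j : coord) : scalar_field :=
  fun h t =>
    / 2 * sum2 (fun l => inv_metric g k l h t *
      (pd i (g j l) h t + pd j (g i l) h t - pd l (g i j) h t)).

(** The pull-back by phi of the Levi-Civita connection of S^3, applied to a
    field V tangent to S^3 along phi: the component of the derivative of V in
    R^4 that is orthogonal to the position vector phi. *)
Definition nabla (phi : field4) (i : coord) (V : field4) : field4 :=
  fun a h t => pd i (V a) h t - dot (pd4 i V) phi h t * phi a h t.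

(** tau(phi) = trace_g (nabla d phi). *)
Definition tension (g : bilinear_field) (phi : field4) : field4 :=
  fun a h t =>
    sum2 (fun i => sum2 (fun j => inv_metric g i j h t *
      (nabla phi i (pd4 j phi) a h t
       - sum2 (fun k => christoffel g k i j h t * pd k (phi a) h t)))).

(** Jiang's stress-bienergy tensor
      S_2(X,Y) = (|tau|^2 / 2 + <d phi, nabla tau>) <X,Y>
                 - <d phi(X), nabla_Y tau> - <d phi(Y), nabla_X tau>. *)
Definition stress_bienergy (g : bilinear_field) (phi : field4)
  : bilinear_field :=
  fun i j h t =>
    (/ 2 * dot (tension g phi) (tension g phi) h t
     + sum2 (fun k => sum2 (fun l => inv_metric g k l h t *
         dot (pd4 k phi) (nabla phi l (tension g phi)) h t)))
      * g i j h t
    - dot (pd4 i phi) (nabla phi j (tension g phi)) h t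
    - dot (pd4 j phi) (nabla phi i (tension g phi)) h t.

(** (div S)_j = g^{ik} (nabla_k S)_{ij}. *)
Definition divergence (g S : bilinear_field) : covector_field :=
  fun j h t =>
    sum2 (fun i => sum2 (fun k => inv_metric g i k h t *
      (pd k (S i j) h t
       - sum2 (fun l => christoffel g l k i h t * S l j h t)
       - sum2 (fun l => christoffel g l k j h t * S i l h t)))).

Definition immersion_S3 (phi : field4) : Prop :=
  (forall a, smooth (phi a)) /\
  (forall h t, dot phi phi h t = 1) /\
  (forall (h t : R) (v : coord -> R),
     (forall a, sum2 (fun i => v i * pd i (phi a) h t) = 0) ->
     forall i, v i = 0).

Definition isometric (g : bilinear_field) (phi : field4) : Prop :=
  forall i j h t, dot (pd4 i phi) (pd4 j phi) h t = g i j h t.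

Definition riemannian_immersion_S3 (g : bilinear_field) (phi : field4)
  : Prop :=
  riemannian_metric g /\ immersion_S3 phi /\ isometric g phi.

Definition biconservative_immersion_S3 (g : bilinear_field) (phi : field4)
  : Prop :=
  riemannian_immersion_S3 g phi /\
  (forall j h t, divergence g (stress_bienergy g phi) j h t = 0).

(** * The functions F and Phi^i

    [Cs] stands for C^*, and [xi01 < xi02] for the two positive zeros of
    [T C].  Coquelicot's [iota P] is the unique [x] such that [P x] when there
    is one. *)

Definition lim_right (f : R -> R) (a : R) : R :=
  iota (fun l : R => filterlim f (at_right a) (locally l)).

Definition lim_left (f : R -> R) (a : R) : R :=
  iota (fun l : R => filterlim f (at_left a) (locally l)).

Definition T (C xi : R) : R := - Rpower xi (8 / 3) + 3 * C * xi ^ 2 - 3.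

Definition xi00 (C : R) : R := Rpower (9 / 4 * C) (3 / 2).

Definition h0 (C Cs xi : R) : R :=
  RInt (fun tau => sqrt ((3 * tau ^ 2 - Cs ^ 2 * T C tau)
                         / (tau ^ 4 * T C tau)))
       (xi00 C) xi.

Definition h0_m1 (C Cs xi01 : R) : R := lim_right (h0 C Cs) xi01.
Definition h0_p1 (C Cs xi02 : R) : R := lim_left (h0 C Cs) xi02.

(** The point h_{0,k}; meaningful for [k <> 0] only. *)
Definition h_node (C Cs xi01 xi02 : R) (k : Z) : R :=
  let hm := h0_m1 C Cs xi01 in
  let hp := h0_p1 C Cs xi02 in
  if (1 <=? k)%Z then IZR k * hp - IZR (k - 1) * hm
  else - IZR k * hm + IZR (k + 1) * hp.

Definition h_branch (C Cs xi01 xi02 : R) (k : Z) (xi : R) : R :=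
  let hm := h0_m1 C Cs xi01 in
  let hp := h0_p1 C Cs xi02 in
  if Z.even k then IZR k * (hp - hm) + h0 C Cs xi
  else IZR (k + 1) * hp - IZR (k - 1) * hm - h0 C Cs xi.

(** The value of F at h_{0,k}, [k <> 0]. *)
Definition F_node (xi01 xi02 : R) (k : Z) : R :=
  if (1 <=? k)%Z then (if Z.even k then xi01 else xi02)
  else (if Z.even k then xi02 else xi01).

(** The graph of F: on the image of the k-th branch h_k, F is the inverse
    xi_k of h_k. *)
Definition F_graph (C Cs xi01 xi02 h xi : R) : Prop :=
  (exists k : Z, xi01 < xi < xi02 /\ h = h_branch C Cs xi01 xi02 k xi) \/
  (exists k : Z, k <> 0%Z /\ h = h_node C Cs xi01 xi02 k
                 /\ xi = F_node xi01 xi02 k).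

Definition F (C Cs xi01 xi02 h : R) : R :=
  iota (fun xi : R => F_graph C Cs xi01 xi02 h xi).

Definition metric_CCs (C Cs xi01 xi02 : R) : bilinear_field :=
  fun i j h _ =>
    let Fh := F C Cs xi01 xi02 h in
    match i, j with
    | ch, ch => 3 * Fh ^ 2 / (3 * Fh ^ 2 - Cs ^ 2 * T C Fh)
    | cth, cth => 1 / Fh ^ 2
    | _, _ => 0
    end.

Definition zeta0_int (C xi : R) : R :=
  RInt (fun tau => sqrt C * Rpower tau (4 / 3)
                   / ((-1 + C * tau ^ 2) * sqrt (T C tau)))
       (xi00 C) xi.

Definition zeta0_m1 (C xi01 : R) : R := lim_right (zeta0_int C) xi01.
Definition zeta0_p1 (C xi02 : R) : R := lim_left (zeta0_int C) xi02.

(** zeta_0 extended to the closed interval [xi01, xi02]. *)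
Definition zeta0 (C xi01 xi02 xi : R) : R :=
  if Req_EM_T xi xi01 then zeta0_m1 C xi01
  else if Req_EM_T xi xi02 then zeta0_p1 C xi02
  else zeta0_int C xi.

Definition phase_constants (C xi01 xi02 : R) (c : Z -> R) : Prop :=
  let zm := zeta0_m1 C xi01 in
  let zp := zeta0_p1 C xi02 in
  forall k : Z, exists m : Z,
    c k = (if Z.even k then IZR k * (zp - zm) + c 0%Z
           else IZR (k - 1) * zm - IZR (k + 1) * zp - c 0%Z)
          + IZR m * (2 * PI).

Definition Phi1_branch (C xi01 xi02 : R) (c : Z -> R) (k : Z) (xi : R) : R :=
  sqrt (1 - 1 / (C * xi ^ 2)) * cos (zeta0 C xi01 xi02 xi + c k).

Definition Phi2_branch (C xi01 xi02 : R) (c : Z -> R) (k : Z) (xi : R) : R :=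
  powerRZ (-1) k
  * (sqrt (1 - 1 / (C * xi ^ 2)) * sin (zeta0 C xi01 xi02 xi + c k)).

(** [h] lies in the closed interval on which Phi^i = Phi^i_k o F. *)
Definition in_piece (C Cs xi01 xi02 : R) (k : Z) (h : R) : Prop :=
  let node := h_node C Cs xi01 xi02 in
  if (1 <=? k)%Z then node k <= h <= node (k + 1)%Z
  else if (k =? 0)%Z then node (-1)%Z <= h <= node 1%Z
  else node (k - 1)%Z <= h <= node k.

(** Consecutive closed intervals share an endpoint, where the two
    prescriptions agree. *)
Definition glue (C Cs xi01 xi02 : R) (Phik : Z -> R -> R) (h : R) : R :=
  iota (fun y : R => exists k : Z,
    in_piece C Cs xi01 xi02 k h /\ y = Phik k (F C Cs xi01 xi02 h)).

Definition Phi1 (C Cs xi01 xi02 : R) (c : Z -> R) (h : R) : R :=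
  glue C Cs xi01 xi02 (Phi1_branch C xi01 xi02 c) h.

Definition Phi2 (C Cs xi01 xi02 : R) (c : Z -> R) (h : R) : R :=
  glue C Cs xi01 xi02 (Phi2_branch C xi01 xi02 c) h.

Definition Phi3 (C Cs xi01 xi02 : R) (h : R) : R :=
  1 / (sqrt C * F C Cs xi01 xi02 h).

Definition Phi4 (C Cs xi01 xi02 : R) (h : R) : R :=
  1 / (sqrt C * F C Cs xi01 xi02 h).

Definition Phi_CCs (C Cs xi01 xi02 : R) (c : Z -> R) : field4 :=
  fun a h theta =>
    match a with
    | e1 => Phi1 C Cs xi01 xi02 c h
    | e2 => Phi2 C Cs xi01 xi02 c h
    | e3 => Phi3 C Cs xi01 xi02 h * cos (sqrt C * theta)
    | e4 => Phi4 C Cs xi01 xi02 h * sin (sqrt C * theta)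
    end.

(* Main.v *)
Require Import Defs.
From Stdlib Require Import Reals ZArith Lra Lia FunctionalExtensionality.
From Coquelicot Require Import Coquelicot.
Open Scope R_scope.

(** The proof has an analytic and a geometric half, joined by a system of
    ordinary differential equations.

    Analysis.  In the variable [x = xi^(2/3)] the function [T] becomes the
    quartic [-x^4 + 3 C x^3 - 3], which factors as
    [(x - x1) (x2 - x) q(x)] with [q > 0].  Writing
    [x(u) = (x1 + x2)/2 - (x2 - x1)/2 cos u] turns [sqrt T] into
    [(x2 - x1)/2 sin u sqrt q], so that both improper integrals [h_0] and
    [zeta_0] become integrals over [u] of smooth positive functions of [cos u]
    ([h0_xi_path], [zeta0_xi_path]).  Their primitives [H] and [Z] are defined
    for all real [u]; since the integrands are even and 2 pi-periodic, the
    branches [h_k] and the phases [zeta_0 + c_k] are nothing but [H] and, up to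
    sign and multiples of 2 pi, [Z + c_0] on the successive intervals
    [k pi <= u <= (k+1) pi] ([primitive_zigzag]).  Hence
    [F (H u) = x(u)^(3/2)] and
    [(Phi^1, Phi^2) (H u) = sqrt (1 - 1/(C F^2)) (cos, sin)(Z u + c_0)] for every
    [u] ([F_h_primitive], [Phi1_h_primitive], [Phi2_h_primitive]): the gluing
    disappears.  As [H] is an increasing bijection of the line with positive
    derivative, [y = F^(1/3)], the signed square root [p] of [T(F)] and the angle
    [psi] are differentiable functions of [h] that solve an explicit autonomous
    system ([profile], [profile_of_inverse]); smoothness follows from the system
    by bootstrapping ([profile_smooth]).

    Geometry.  Along a solution of that system the map is a rotational surface
    in the sphere, and everything is a rational expression in [y], [p],
    [s], the radius and the trigonometric functions.  With an explicit unit normal [N] the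
    Gauss and Weingarten equations hold with principal curvatures
    [k1 = F^(4/3) / (3 sqrt 3)] and [k2 = - 3 k1]; this is the relation
    [A (grad f) = - f/2 grad f].  The tension field is then [f N] with
    [f = k1 + k2], the stress-bienergy tensor is [- f^2/2 g + 2 f b], where [b]
    is the second fundamental form, and its divergence vanishes because
    [k1^3 g_(theta theta)^2] is constant
    ([biconservative_of_fundamental_equations], [biconservative_rotational]). *)

(** * Functions of one variable of class C^n *)

Fixpoint Cn (n : nat) (f : R -> R) : Prop :=
  match n with
  | O => forall x, continuous f x
  | S m => (forall x, ex_derive f x) /\ Cn m (Derive f)
  end.

Lemma Cn_of_derive n f f' :
  (forall x, is_derive f x (f' x)) -> Cn n f' -> Cn (S n) f.
Proof.
  intros Hd Hf'. split.
  - intros x. exists (f' x). apply Hd.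
  - replace (Derive f) with f'; auto.
    apply functional_extensionality; intros x.
    symmetry. apply is_derive_unique, Hd.
Qed.

Lemma Cn_S n f : Cn (S n) f -> Cn n f.
Proof.
  revert f; induction n as [|n IH]; intros f [Hd Hc].
  - intros x. apply @ex_derive_continuous, Hd.
  - split; auto.
Qed.

Lemma Cn_is_derive n f x : Cn (S n) f -> is_derive f x (Derive f x).
Proof. intros [Hd _]. apply Derive_correct, Hd. Qed.

Lemma Cn_const n c : Cn n (fun _ => c).
Proof.
  revert c; induction n as [|n IH]; intros c.
  - intros x. apply continuous_const.
  - apply (Cn_of_derive n _ (fun _ => 0)); auto.
    intros x. apply (is_derive_const (K := R_AbsRing) (V := R_NormedModule) c).
Qed.

Lemma Cn_id n : Cn n (fun x => x).
Proof.
  destruct n as [|n].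
  - intros x. apply continuous_id.
  - apply (Cn_of_derive n _ (fun _ => 1)); [|apply Cn_const].
    intros x. apply (is_derive_id (K := R_AbsRing)).
Qed.

Lemma Cn_plus n f g : Cn n f -> Cn n g -> Cn n (fun x => f x + g x).
Proof.
  revert f g; induction n as [|n IH]; intros f g Hf Hg.
  - intros x. apply @continuous_plus; auto.
  - apply (Cn_of_derive n _ (fun x => Derive f x + Derive g x)).
    + intros x. apply @is_derive_plus; apply (Cn_is_derive n); auto.
    + apply IH; [apply Hf | apply Hg].
Qed.

Lemma Cn_mult n f g : Cn n f -> Cn n g -> Cn n (fun x => f x * g x).
Proof.
  revert f g; induction n as [|n IH]; intros f g Hf Hg.
  - intros x. apply @continuous_mult; auto.
  - apply (Cn_of_derive n _ (fun x => Derive f x * g x + f x * Derive g x)).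
    + intros x. apply @is_derive_mult; try (apply (Cn_is_derive n); auto).
      intros a b. apply Rmult_comm.
    + apply Cn_plus; apply IH; try (now apply Cn_S); [apply Hf | apply Hg].
Qed.

Lemma Cn_scal n a f : Cn n f -> Cn n (fun x => a * f x).
Proof. intros Hf. apply Cn_mult; auto. apply Cn_const. Qed.

Lemma Cn_minus n f g : Cn n f -> Cn n g -> Cn n (fun x => f x - g x).
Proof.
  intros Hf Hg.
  replace (fun x => f x - g x) with (fun x => f x + (-1) * g x)
    by (apply functional_extensionality; intros; ring).
  apply Cn_plus; auto. now apply Cn_scal.
Qed.

Lemma Cn_pow n k f : Cn n f -> Cn n (fun x => f x ^ k).
Proof.
  intros Hf; induction k as [|k IH]; simpl.
  - apply Cn_const.
  - now apply Cn_mult.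
Qed.

Lemma Cn_inv n f :
  (forall x, f x <> 0) -> Cn n f -> Cn n (fun x => / f x).
Proof.
  intros Hnz; induction n as [|n IH]; intros Hf.
  - intros x. apply continuous_Rinv_comp; auto.
  - apply (Cn_of_derive n _ (fun x => -1 * Derive f x * (/ f x) ^ 2)).
    + intros x. pose proof (Cn_is_derive n f x Hf) as Hd.
      replace (-1 * Derive f x * (/ f x) ^ 2) with (- Derive f x / f x ^ 2)
        by (field; auto).
      now apply is_derive_inv.
    + apply Cn_mult; [apply Cn_scal, Hf|].
      apply Cn_pow, IH. now apply Cn_S.
Qed.

Lemma Cn_div n f g :
  (forall x, g x <> 0) -> Cn n f -> Cn n g -> Cn n (fun x => f x / g x).
Proof. intros. apply Cn_mult; auto. now apply Cn_inv. Qed.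

Lemma Cn_sqrt n f : (forall x, 0 < f x) -> Cn n f -> Cn n (fun x => sqrt (f x)).
Proof.
  intros Hpos; induction n as [|n IH]; intros Hf.
  - intros x. apply continuous_comp; auto. apply continuous_sqrt.
  - apply (Cn_of_derive n _ (fun x => Derive f x / (2 * sqrt (f x)))).
    + intros x. apply is_derive_sqrt; auto. now apply (Cn_is_derive n).
    + apply Cn_div.
      * intros x. pose proof (sqrt_lt_R0 _ (Hpos x)). lra.
      * apply Hf.
      * apply Cn_scal, IH. now apply Cn_S.
Qed.

Lemma Cn_sin_cos n f :
  Cn n f -> Cn n (fun x => sin (f x)) /\ Cn n (fun x => cos (f x)).
Proof.
  induction n as [|n IH]; intros Hf.
  - split; intros x; apply continuous_comp; auto;
      [apply continuous_sin | apply continuous_cos].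
  - destruct (IH (Cn_S _ _ Hf)) as [Hs Hc].
    assert (Hd : forall x, is_derive f x (Derive f x))
      by (intros; now apply (Cn_is_derive n)).
    split.
    + apply (Cn_of_derive n _ (fun x => Derive f x * cos (f x))).
      * intros x. apply (is_derive_comp sin f); auto. apply is_derive_sin.
      * apply Cn_mult; auto. apply Hf.
    + apply (Cn_of_derive n _ (fun x => Derive f x * (-1 * sin (f x)))).
      * intros x. apply (is_derive_comp cos f); auto.
        replace (-1 * sin (f x)) with (- sin (f x)) by ring. apply is_derive_cos.
      * apply Cn_mult; [apply Hf|]. now apply Cn_scal.
Qed.

Lemma Cn_sin n f : Cn n f -> Cn n (fun x => sin (f x)).
Proof. apply Cn_sin_cos. Qed.

Lemma Cn_cos n f : Cn n f -> Cn n (fun x => cos (f x)).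
Proof. apply Cn_sin_cos. Qed.

(** A product of functions of separate variables keeps that form under partial
    differentiation. *)
Lemma smooth_prod A B :
  (forall n, Cn n A) -> (forall n, Cn n B) -> smooth (fun h t => A h * B t).
Proof.
  intros HA HB n; revert A B HA HB; induction n as [|n IH]; intros A B HA HB h t;
    (assert (Hc : continuity_2d_pt (fun h t => A h * B t) h t)
      by (apply continuity_2d_pt_mult;
          [ apply (continuity_1d_2d_pt_comp A (fun u _ => u));
            [apply continuity_pt_filterlim, (HA O) | apply continuity_2d_pt_id1]
          | apply (continuity_1d_2d_pt_comp B (fun _ v => v));
            [apply continuity_pt_filterlim, (HB O) | apply continuity_2d_pt_id2]])).
  - now split.
  - assert (DA : forall h t, is_derive (fun z => A z * B t) h (Derive A h * B t)).
    { intros h' t'. apply (is_derive_scal_l (K := R_AbsRing) (V := R_NormedModule)).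
      now apply (Cn_is_derive O). }
    assert (DB : forall h t, is_derive (fun z => A h * B z) t (A h * Derive B t)).
    { intros h' t'. apply is_derive_scal.
      now apply (Cn_is_derive O). }
    split; [exact Hc|]. split; [|split; [|split]].
    + eexists. apply DA.
    + eexists. apply DB.
    + replace (fun u v => Derive (fun z => A z * B v) u)
        with (fun u v => Derive A u * B v).
      * apply IH; auto. intros k. apply (HA (S k)).
      * apply functional_extensionality; intros u.
        apply functional_extensionality; intros v.
        symmetry. apply is_derive_unique, DA.
    + replace (fun u v => Derive (fun z => A u * B z) v)
        with (fun u v => A u * Derive B v).
      * apply IH; auto. intros k. apply (HB (S k)).
      * apply functional_extensionality; intros u.
        apply functional_extensionality; intros v.
        symmetry. apply is_derive_unique, DB.
Qed.

Lemma smooth_of_h A : (forall n, Cn n A) -> smooth (fun h _ => A h).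
Proof.
  intros HA.
  replace (fun h (_ : R) => A h) with (fun h (t : R) => A h * 1).
  - apply (smooth_prod A (fun _ => 1)); auto. intros; apply Cn_const.
  - do 2 (apply functional_extensionality; intros). ring.
Qed.
(** * Surfaces whose fundamental forms are diagonal and depend on h only *)

Definition diag_field (P Q : R -> R) : bilinear_field :=
  fun i j h _ =>
    match i, j with
    | ch, ch => P h
    | cth, cth => Q h
    | _, _ => 0
    end.

Lemma pd_ch (u : scalar_field) h t l :
  is_derive (fun x => u x t) h l -> pd ch u h t = l.
Proof. exact (is_derive_unique (fun x => u x t) h l). Qed.

Lemma pd_cth (u : scalar_field) h t l :
  is_derive (u h) t l -> pd cth u h t = l.
Proof. exact (is_derive_unique (u h) t l). Qed.

Lemma pd_diag P Q k i j h t :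
  pd k (diag_field P Q i j) h t =
  match k with
  | ch => diag_field (Derive P) (Derive Q) i j h t
  | cth => 0
  end.
Proof.
  destruct k; simpl.
  - destruct i, j; simpl; auto; apply Derive_const.
  - destruct i, j; exact (Derive_const _ t).
Qed.

Lemma inv_metric_diag E G i j h t :
  E h <> 0 -> G h <> 0 ->
  inv_metric (diag_field E G) i j h t =
  diag_field (fun h => / E h) (fun h => / G h) i j h t.
Proof.
  intros HE HG; unfold inv_metric, det_metric.
  destruct i, j; simpl; field; auto.
Qed.

Lemma christoffel_diag E G k i j h t :
  E h <> 0 -> G h <> 0 ->
  christoffel (diag_field E G) k i j h t =
  match k, i, j with
  | ch, ch, ch => Derive E h / (2 * E h)
  | ch, cth, cth => - Derive G h / (2 * E h)
  | cth, ch, cth | cth, cth, ch => Derive G h / (2 * G h)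
  | _, _, _ => 0
  end.
Proof.
  intros HE HG; unfold christoffel, sum2.
  rewrite !inv_metric_diag, !pd_diag; auto.
  destruct k, i, j; simpl; field; auto.
Qed.

Lemma riemannian_metric_diag E G :
  (forall n, Cn n E) -> (forall n, Cn n G) ->
  (forall h, 0 < E h) -> (forall h, 0 < G h) ->
  riemannian_metric (diag_field E G).
Proof.
  intros CE CG HE HG; split; [|split].
  - assert (S0 : smooth (fun _ _ => 0))
      by (apply (smooth_of_h (fun _ => 0)); intros; apply Cn_const).
    intros i j; destruct i, j;
      [exact (smooth_of_h E CE) | exact S0 | exact S0 | exact (smooth_of_h G CG)].
  - intros i j h t; now destruct i, j.
  - intros h t v Hv; unfold sum2; simpl.
    specialize (HE h); specialize (HG h).
    assert (Hs : 0 < v ch ^ 2 \/ 0 < v cth ^ 2)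
      by (destruct Hv; [left | right]; now apply pow2_gt_0).
    pose proof (pow2_ge_0 (v ch)); pose proof (pow2_ge_0 (v cth)).
    destruct Hs; nra.
Qed.

(** The metric being positive, a vector in the kernel of the differential has
    length 0. *)
Lemma immersion_of_isometric g phi :
  riemannian_metric g -> isometric g phi ->
  (forall a, smooth (phi a)) -> (forall h t, dot phi phi h t = 1) ->
  immersion_S3 phi.
Proof.
  intros (_ & _ & Hpos) Hiso Hsm H1; split; [|split]; auto.
  intros h t v Hv.
  assert (Hz : sum2 (fun i => sum2 (fun j => g i j h t * v i * v j)) = 0).
  { transitivity (sum4 (fun a => sum2 (fun i => v i * pd i (phi a) h t)
                                 * sum2 (fun i => v i * pd i (phi a) h t))).
    - unfold sum2. rewrite <- !Hiso. unfold dot, sum4, pd4. ring.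
    - unfold sum4. rewrite !Hv. ring. }
  intros i. destruct (Req_dec (v i) 0) as [|Hn]; auto.
  exfalso. assert (Hp := Hpos h t v).
  destruct i; lapply Hp; auto; lra.
Qed.

Lemma divergence_diag E G P Q j h t :
  (forall h, 0 < E h) -> (forall h, 0 < G h) ->
  divergence (diag_field E G) (diag_field P Q) j h t =
  match j with
  | ch => (Derive P h - Derive E h / E h * P h) / E h
          + Derive G h / (2 * G h) * (P h / E h - Q h / G h)
  | cth => 0
  end.
Proof.
  intros HE HG; specialize (HE h); specialize (HG h).
  unfold divergence, sum2.
  rewrite !inv_metric_diag, !christoffel_diag, !pd_diag by lra.
  destruct j; simpl; field; lra.
Qed.

Lemma dot_comm V W h t : dot V W h t = dot W V h t.
Proof. unfold dot, sum4. ring. Qed.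

(** The Gauss formula: the derivatives of [d phi] split into their tangential
    part, given by the Christoffel symbols, their part along [N], and their
    part along the position vector.  Taking the trace leaves the normal part. *)
Lemma tension_of_gauss E G k1 k2 (phi N : field4) :
  (forall h, 0 < E h) -> (forall h, 0 < G h) ->
  (forall h t, dot phi phi h t = 1) ->
  (forall h t, dot N phi h t = 0) ->
  (forall i h t, dot (pd4 i phi) phi h t = 0) ->
  (forall a h t, pd ch (pd ch (phi a)) h t =
     Derive E h / (2 * E h) * pd ch (phi a) h t
     + E h * k1 h * N a h t - E h * phi a h t) ->
  (forall a h t, pd cth (pd cth (phi a)) h t =
     - Derive G h / (2 * E h) * pd ch (phi a) h t
     + G h * k2 h * N a h t - G h * phi a h t) ->
  tension (diag_field E G) phi = fun a h t => (k1 h + k2 h) * N a h t.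
Proof.
  intros HE HG H1 HN Hd Ghh Gtt.
  apply functional_extensionality; intros a.
  apply functional_extensionality; intros h.
  apply functional_extensionality; intros t.
  specialize (HE h); specialize (HG h).
  unfold tension, sum2.
  rewrite !inv_metric_diag, !christoffel_diag by lra. simpl.
  assert (Dh : dot (pd4 ch (pd4 ch phi)) phi h t = - E h).
  { transitivity (Derive E h / (2 * E h) * dot (pd4 ch phi) phi h t
      + E h * k1 h * dot N phi h t - E h * dot phi phi h t).
    - unfold dot, sum4, pd4. rewrite !Ghh. ring.
    - rewrite Hd, HN, H1. ring. }
  assert (Dt : dot (pd4 cth (pd4 cth phi)) phi h t = - G h).
  { transitivity (- Derive G h / (2 * E h) * dot (pd4 ch phi) phi h t
      + G h * k2 h * dot N phi h t - G h * dot phi phi h t).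
    - unfold dot, sum4, pd4. rewrite !Gtt. ring.
    - rewrite Hd, HN, H1. ring. }
  change (Derive (fun x => phi a x t) h) with (pd ch (phi a) h t).
  change (Derive (phi a h) t) with (pd cth (phi a) h t).
  unfold nabla at 1 4. rewrite Dh, Dt.
  change (pd4 ch phi a) with (pd ch (phi a)).
  change (pd4 cth phi a) with (pd cth (phi a)).
  rewrite Ghh, Gtt. field. lra.
Qed.

(** With [tau = f N] the Weingarten equations express every term of the
    stress-bienergy tensor through the shape operator:
    [S_2 = - f^2/2 g + 2 f b]. *)
Lemma stress_bienergy_of_weingarten E G k (phi N : field4) f :
  (forall h, 0 < E h) -> (forall h, 0 < G h) ->
  isometric (diag_field E G) phi ->
  (forall h t, dot N N h t = 1) ->
  (forall i h t, dot (pd4 i phi) phi h t = 0) ->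
  (forall i h t, dot (pd4 i phi) N h t = 0) ->
  (forall h, ex_derive f h) ->
  (forall a h t, is_derive (fun x => N a x t) h (- k ch h * pd ch (phi a) h t)) ->
  (forall a h t, is_derive (N a h) t (- k cth h * pd cth (phi a) h t)) ->
  (forall h, f h = k ch h + k cth h) ->
  tension (diag_field E G) phi = (fun a h t => f h * N a h t) ->
  stress_bienergy (diag_field E G) phi =
  diag_field (fun h => E h * (- / 2 * f h ^ 2 + 2 * f h * k ch h))
             (fun h => G h * (- / 2 * f h ^ 2 + 2 * f h * k cth h)).
Proof.
  intros HE HG Hiso HNN Hd HdN Hf Wh Wt Hfk Ht.
  apply functional_extensionality; intros i.
  apply functional_extensionality; intros j.
  apply functional_extensionality; intros h.
  apply functional_extensionality; intros t.
  specialize (HE h); specialize (HG h).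
  assert (Hn : forall i j, dot (pd4 i phi) (nabla phi j (tension (diag_field E G) phi)) h t
                = - f h * k j h * diag_field E G i j h t).
  { intros i' j'. rewrite Ht.
    set (fN := fun (a : axis) (h t : R) => f h * N a h t).
    assert (Hp : forall a, pd j' (fN a) h t =
       match j' with ch => Derive f h | cth => 0 end * N a h t
       - f h * k j' h * pd j' (phi a) h t).
    { intros a; destruct j'.
      - apply (pd_ch (fN a)).
        replace (_ - _) with
          (Derive f h * N a h t + f h * (- k ch h * pd ch (phi a) h t)) by ring.
        apply (is_derive_mult f (fun x => N a x t)); auto.
        + apply Derive_correct, Hf.
        + intros; apply Rmult_comm.
      - apply (pd_cth (fN a)).
        replace (_ - _) with
          (f h * (- k cth h * pd cth (phi a) h t)) by ring.
        now apply (is_derive_scal (N a h)). }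
    transitivity (match j' with ch => Derive f h | cth => 0 end
                    * dot (pd4 i' phi) N h t
                  - f h * k j' h * dot (pd4 i' phi) (pd4 j' phi) h t
                  - dot (pd4 j' fN) phi h t * dot (pd4 i' phi) phi h t).
    - unfold dot at 1 2 3 5, nabla, sum4.
      rewrite !Hp. unfold pd4. ring.
    - rewrite HdN, Hd, Hiso. ring. }
  unfold stress_bienergy, sum2.
  rewrite !inv_metric_diag, !Hn by lra. rewrite Ht.
  replace (dot (fun a h t => f h * N a h t) (fun a h t => f h * N a h t) h t)
    with (f h ^ 2).
  2: { transitivity (f h ^ 2 * dot N N h t); [rewrite HNN; ring|].
       unfold dot, sum4. ring. }
  destruct i, j; simpl; rewrite !Hfk; field; lra.
Qed.

(** If [k2 = - 3 k1], then [f = - 2 k1], the stress-bienergy tensor is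
    [k1^2 diag (- 6 E, 10 G)], and the h-component of its divergence is a
    multiple of [3 k1' G + 2 k1 G']. *)
Lemma biconservative_of_fundamental_equations E G k1 k2 (phi N : field4) :
  (forall n, Cn n E) -> (forall n, Cn n G) -> (forall n, Cn n k1) -> (forall n, Cn n k2) ->
  (forall h, 0 < E h) -> (forall h, 0 < G h) ->
  (forall a, smooth (phi a)) ->
  (forall h t, dot phi phi h t = 1) ->
  isometric (diag_field E G) phi ->
  (forall i h t, dot (pd4 i phi) phi h t = 0) ->
  (forall h t, dot N N h t = 1) ->
  (forall h t, dot N phi h t = 0) ->
  (forall i h t, dot (pd4 i phi) N h t = 0) ->
  (forall a h t, pd ch (pd ch (phi a)) h t =
     Derive E h / (2 * E h) * pd ch (phi a) h t
     + E h * k1 h * N a h t - E h * phi a h t) ->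
  (forall a h t, pd cth (pd cth (phi a)) h t =
     - Derive G h / (2 * E h) * pd ch (phi a) h t
     + G h * k2 h * N a h t - G h * phi a h t) ->
  (forall a h t, is_derive (fun x => N a x t) h (- k1 h * pd ch (phi a) h t)) ->
  (forall a h t, is_derive (N a h) t (- k2 h * pd cth (phi a) h t)) ->
  (forall h, k2 h = - 3 * k1 h) ->
  (forall h, 3 * Derive k1 h * G h + 2 * k1 h * Derive G h = 0) ->
  biconservative_immersion_S3 (diag_field E G) phi.
Proof.
  intros CE CG Ck1 Ck2 HE HG Hsm H1 Hiso Hd HNN HN HdN Ghh Gtt Wh Wt Hk Hcod.
  assert (Hg : riemannian_metric (diag_field E G))
    by now apply riemannian_metric_diag.
  split; [split; [|split]|]; auto.
  { now apply immersion_of_isometric with (diag_field E G). }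
  intros j h t.
  rewrite (stress_bienergy_of_weingarten E G
    (fun i => match i with ch => k1 | cth => k2 end) phi N (fun h => k1 h + k2 h));
    auto.
  - rewrite divergence_diag; auto. destruct j; auto.
    assert (dE : is_derive E h (Derive E h)) by (now apply (Cn_is_derive O)).
    assert (d1 : is_derive k1 h (Derive k1 h)) by (now apply (Cn_is_derive O)).
    replace (fun h => E h * (- / 2 * (k1 h + k2 h) ^ 2 + 2 * (k1 h + k2 h) * k1 h))
      with (fun h => -6 * E h * k1 h ^ 2)
      by (apply functional_extensionality; intros x; rewrite !Hk; field).
    replace (Derive (fun h => -6 * E h * k1 h ^ 2) h) with
      (-6 * (Derive E h * k1 h ^ 2 + 2 * E h * k1 h * Derive k1 h)).
    2: { symmetry; apply is_derive_unique. auto_derive.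
         - repeat split; eexists; eauto.
         - change (Derive (fun x => E x)) with (Derive E).
           change (Derive (fun x => k1 x)) with (Derive k1). ring. }
    rewrite Hk. specialize (Hcod h). specialize (HE h). specialize (HG h).
    transitivity (- 4 * k1 h / G h * (3 * Derive k1 h * G h + 2 * k1 h * Derive G h));
      [field; lra | rewrite Hcod; field; lra].
  - intros x. apply (Cn_plus 1); auto.
  - now apply tension_of_gauss.
Qed.
(** * The rotational surface attached to a solution of an ODE system *)

(** The equations satisfied by [y = F^(1/3)], by the square root [p] of [T(F)]
    that changes sign at the turning points of [F], and by the angle [psi] of
    the first two coordinates, with [K = sqrt C].  The time change [s] is left
    arbitrary; for [F] it is [1 / sqrt (3 F^2 - Cs^2 T(F))].  Unlike
    [F' = +- F^2 sqrt (T(F) / (3 F^2 - Cs^2 T(F)))], the system is smooth at the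
    turning points. *)
Record profile (K : R) (y p psi s : R -> R) : Prop := {
  profile_K : 0 < K;
  profile_y : forall h, 0 < y h;
  profile_s : forall h, 0 < s h;
  profile_rho : forall h, 0 < K ^ 2 * y h ^ 6 - 1;
  profile_p : forall h, p h ^ 2 = - y h ^ 8 + 3 * K ^ 2 * y h ^ 6 - 3;
  profile_dy : forall h, is_derive y h (y h ^ 4 * p h * s h / 3);
  profile_dp : forall h,
    is_derive p h ((9 * K ^ 2 * y h ^ 9 - 4 * y h ^ 11) * s h / 3);
  profile_dpsi : forall h,
    is_derive psi h (K * y h ^ 10 * s h / (K ^ 2 * y h ^ 6 - 1))
}.

Definition rho (K : R) (y : R -> R) (h : R) : R := sqrt (K ^ 2 * y h ^ 6 - 1).

(** The immersion for [F = y^3] and [K = sqrt C]; its first radius is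
    [sqrt (1 - 1 / (C F^2)) = rho / (K y^3)]. *)
Definition rotational (K : R) (y psi : R -> R) : field4 :=
  fun a h t =>
    match a with
    | e1 => rho K y h / (K * y h ^ 3) * cos (psi h)
    | e2 => rho K y h / (K * y h ^ 3) * sin (psi h)
    | e3 => 1 / (K * y h ^ 3) * cos (K * t)
    | e4 => 1 / (K * y h ^ 3) * sin (K * t)
    end.

Definition rotational_h (K : R) (y p psi s : R -> R) : field4 :=
  fun a h t =>
    s h / (K * rho K y h) *
    match a with
    | e1 => p h * cos (psi h) - K * y h ^ 7 * sin (psi h)
    | e2 => p h * sin (psi h) + K * y h ^ 7 * cos (psi h)
    | e3 => - (p h * rho K y h) * cos (K * t)
    | e4 => - (p h * rho K y h) * sin (K * t)
    end.

Definition rotational_t (K : R) (y : R -> R) : field4 :=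
  fun a h t =>
    match a with
    | e1 | e2 => 0
    | e3 => - / y h ^ 3 * sin (K * t)
    | e4 => / y h ^ 3 * cos (K * t)
    end.

(** Up to the factor [1 / sqrt E], the cross product of the position and the
    h-derivative in the moving frame of the two rotations. *)
Definition normal_field (K : R) (y p psi : R -> R) : field4 :=
  fun a h t =>
    / (sqrt 3 * K * rho K y h) *
    match a with
    | e1 => - y h * cos (psi h) - K * p h * sin (psi h)
    | e2 => - y h * sin (psi h) + K * p h * cos (psi h)
    | e3 => y h * rho K y h * cos (K * t)
    | e4 => y h * rho K y h * sin (K * t)
    end.

Lemma rho_pos K y p psi s h : profile K y p psi s -> 0 < rho K y h.
Proof. intros H. apply sqrt_lt_R0, H. Qed.

Lemma rho_sqr K y p psi s h :
  profile K y p psi s -> rho K y h ^ 2 = K ^ 2 * y h ^ 6 - 1.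
Proof. intros H. apply pow2_sqrt. left; apply H. Qed.

Lemma is_derive_rho K y p psi s h :
  profile K y p psi s ->
  is_derive (rho K y) h (K ^ 2 * y h ^ 9 * p h * s h / rho K y h).
Proof.
  intros H. pose proof (rho_pos _ _ _ _ _ h H) as Hr.
  pose proof (profile_rho _ _ _ _ _ H h) as Hr'.
  pose proof (profile_dy _ _ _ _ _ H h) as Hd.
  unfold rho. auto_derive.
  - repeat split; auto. eexists; apply Hd.
  - change (Derive (fun x => y x) h) with (Derive y h).
    rewrite (is_derive_unique _ _ _ Hd). fold (rho K y h).
    replace (K * (K * 1) * (y h * (y h * (y h * (y h * (y h * (y h * 1)))))) + - (1))
      with (K ^ 2 * y h ^ 6 - 1) by ring.
    fold (rho K y h). field. lra.
Qed.

(** [auto_derive] leaves terms [Derive f x] for the unknown functions [f]; they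
    are replaced by the values that the context gives. *)
Ltac derive_known :=
  auto_derive;
  [ repeat split; try (eexists; eassumption); auto
  | repeat match goal with
    | H : is_derive ?f ?x _ |- context [Derive (fun z => ?f z) ?x] =>
        change (Derive (fun z => f z) x) with (Derive f x);
        rewrite (is_derive_unique f x _ H)
    end ].

Lemma pd_ch_rotational K y p psi s a h t :
  profile K y p psi s ->
  pd ch (rotational K y psi a) h t = rotational_h K y p psi s a h t.
Proof.
  intros H.
  pose proof (rho_pos _ _ _ _ _ h H) as Hr.
  pose proof (rho_sqr _ _ _ _ _ h H) as Hr2.
  pose proof (is_derive_rho _ _ _ _ _ h H) as Hdr.
  destruct H as [HK Hy Hs Hr' Hp Hdy Hdp Hdps].
  specialize (Hdy h); specialize (Hdps h); specialize (Hy h).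
  specialize (Hr' h).
  assert (K * y h ^ 3 <> 0)
    by (apply Rgt_not_eq, Rmult_lt_0_compat; auto; now apply pow_lt).
  unfold rotational_h.
  rewrite <- Hr2 in Hdps.
  apply (pd_ch (rotational K y psi a)).
  destruct a; unfold rotational; derive_known.
  all: field_simplify_eq; try (repeat split; lra).
  all: ring [Hr2].
Qed.
Lemma pd_cth_rotational K y p psi s a h t :
  profile K y p psi s ->
  pd cth (rotational K y psi a) h t = rotational_t K y a h t.
Proof.
  intros H. pose proof (profile_K _ _ _ _ _ H) as HK.
  pose proof (profile_y _ _ _ _ _ H h) as Hy.
  apply (pd_cth (rotational K y psi a)).
  destruct a; unfold rotational, rotational_t; auto_derive; auto; try ring.
  all: field; lra.
Qed.

(** [3 F^2 / (3 F^2 - Cs^2 T(F))] and [1 / F^2] for [F = y^3]. *)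
Definition metric_h (y s : R -> R) (h : R) : R := 3 * y h ^ 6 * s h ^ 2.
Definition metric_t (y : R -> R) (h : R) : R := / y h ^ 6.
Definition curvature_h (y : R -> R) (h : R) : R := y h ^ 4 / (3 * sqrt 3).
Definition curvature_t (y : R -> R) (h : R) : R := - y h ^ 4 / sqrt 3.

Lemma sqrt3_sqr : sqrt 3 ^ 2 = 3.
Proof. apply pow2_sqrt; lra. Qed.

Lemma Derive_metric_h K y p psi s h :
  profile K y p psi s -> ex_derive s h ->
  Derive (metric_h y s) h / (2 * metric_h y s h) =
  y h ^ 3 * p h * s h + Derive s h / s h.
Proof.
  intros H Hs. pose proof (profile_y _ _ _ _ _ H h) as Hy.
  pose proof (profile_s _ _ _ _ _ H h) as Hs0.
  pose proof (profile_dy _ _ _ _ _ H h) as Hdy.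
  pose proof (Derive_correct _ _ Hs) as Hds.
  rewrite (is_derive_unique (metric_h y s) h
    (6 * y h ^ 9 * p h * s h ^ 3 + 6 * y h ^ 6 * s h * Derive s h)).
  - unfold metric_h. field. lra.
  - generalize dependent (Derive s h); intros s' Hds.
    unfold metric_h. derive_known. field.
Qed.

Lemma Derive_metric_t K y p psi s h :
  profile K y p psi s ->
  Derive (metric_t y) h = - 2 * p h * s h / y h ^ 3.
Proof.
  intros H. pose proof (profile_y _ _ _ _ _ H h) as Hy.
  pose proof (profile_dy _ _ _ _ _ H h) as Hdy.
  apply is_derive_unique. unfold metric_t. derive_known.
  - apply Rgt_not_eq. now apply (pow_lt (y h) 6).
  - field. lra.
Qed.

(** The derivative of the normal is parallel to the h-derivative of the position
    because a rotational surface is curved principally along its meridians. *)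
Lemma is_derive_normal_h K y p psi s a h t :
  profile K y p psi s ->
  is_derive (fun x => normal_field K y p psi a x t) h
    (- curvature_h y h * rotational_h K y p psi s a h t).
Proof.
  intros H.
  pose proof (rho_pos _ _ _ _ _ h H) as Hr.
  pose proof (rho_sqr _ _ _ _ _ h H) as Hr2.
  pose proof (is_derive_rho _ _ _ _ _ h H) as Hdr.
  destruct H as [HK Hy Hs Hr' Hp Hdy Hdp Hdps].
  specialize (Hdy h); specialize (Hdp h); specialize (Hdps h); specialize (Hy h);
  specialize (Hp h).
  rewrite <- Hr2 in Hdps.
  assert (H3 : 0 < sqrt 3) by (apply sqrt_lt_R0; lra).
  unfold normal_field, rotational_h, curvature_h.
  destruct a; derive_known.
  all: try (apply Rgt_not_eq; repeat apply Rmult_lt_0_compat; lra).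
  all: field_simplify_eq; try (repeat split; lra).
  all: ring [Hr2 Hp sqrt3_sqr].
Qed.

Lemma is_derive_normal_t K y p psi s a h t :
  profile K y p psi s ->
  is_derive (normal_field K y p psi a h) t
    (- curvature_t y h * rotational_t K y a h t).
Proof.
  intros H.
  pose proof (rho_pos _ _ _ _ _ h H) as Hr.
  destruct H as [HK Hy Hs Hr' Hp Hdy Hdp Hdps].
  specialize (Hy h).
  assert (H3 : 0 < sqrt 3) by (apply sqrt_lt_R0; lra).
  unfold normal_field, rotational_t, curvature_t.
  destruct a; auto_derive; auto; try (field; repeat split; lra).

Qed.

(** The derivative of the unknown [s] enters only through the Christoffel symbol
    [E' / (2 E)], so it stays arbitrary. *)
Lemma gauss_hh K y p psi s a h t :
  profile K y p psi s -> ex_derive s h ->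
  is_derive (fun x => rotational_h K y p psi s a x t) h
    (Derive (metric_h y s) h / (2 * metric_h y s h) * rotational_h K y p psi s a h t
     + metric_h y s h * curvature_h y h * normal_field K y p psi a h t
     - metric_h y s h * rotational K y psi a h t).
Proof.
  intros H Hs'. rewrite (Derive_metric_h K y p psi s h H Hs').
  pose proof (rho_pos _ _ _ _ _ h H) as Hr.
  pose proof (rho_sqr _ _ _ _ _ h H) as Hr2.
  pose proof (is_derive_rho _ _ _ _ _ h H) as Hdr.
  pose proof (Derive_correct _ _ Hs') as Hds.
  destruct H as [HK Hy Hs Hr' Hp Hdy Hdp Hdps].
  specialize (Hdy h); specialize (Hdp h); specialize (Hdps h); specialize (Hy h);
  specialize (Hp h); specialize (Hs h).
  rewrite <- Hr2 in Hdps.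
  assert (H3 : 0 < sqrt 3) by (apply sqrt_lt_R0; lra).
  unfold normal_field, rotational_h, rotational, curvature_h, metric_h.
  generalize dependent (Derive s h); intros s' Hds.
  destruct a; derive_known.
  all: try (apply Rgt_not_eq; repeat apply Rmult_lt_0_compat; lra).
  all: field_simplify_eq; try (repeat split; lra).
  all: ring [Hr2 Hp sqrt3_sqr].
Qed.
Lemma gauss_tt K y p psi s a h t :
  profile K y p psi s ->
  is_derive (rotational_t K y a h) t
    (- Derive (metric_t y) h / (2 * metric_h y s h) * rotational_h K y p psi s a h t
     + metric_t y h * curvature_t y h * normal_field K y p psi a h t
     - metric_t y h * rotational K y psi a h t).
Proof.
  intros H. rewrite (Derive_metric_t K y p psi s h H).
  pose proof (rho_pos _ _ _ _ _ h H) as Hr.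
  pose proof (rho_sqr _ _ _ _ _ h H) as Hr2.
  destruct H as [HK Hy Hs Hr' Hp Hdy Hdp Hdps].
  specialize (Hy h); specialize (Hp h); specialize (Hs h).
  assert (H3 : 0 < sqrt 3) by (apply sqrt_lt_R0; lra).
  unfold normal_field, rotational_h, rotational_t, rotational, curvature_t, metric_h, metric_t.
  destruct a; auto_derive; auto.
  all: field_simplify_eq; try (repeat split; lra).
  all: ring [Hr2 Hp sqrt3_sqr].
Qed.

Lemma cos2_eq x : cos x ^ 2 = 1 - sin x ^ 2.
Proof. rewrite <- !Rsqr_pow2. apply cos2. Qed.

(** The inner products of position, tangent and normal vectors are polynomial
    identities modulo the values of [rho^2], [p^2], [(sqrt 3)^2] and
    [cos^2 + sin^2 = 1]. *)
Ltac inner_products H h u v :=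
  pose proof (rho_pos _ _ _ _ _ h H);
  pose proof (rho_sqr _ _ _ _ _ h H) as Hr2;
  destruct H as [HK Hy Hs Hr' Hp _ _ _];
  specialize (Hy h); specialize (Hs h); specialize (Hp h);
  assert (0 < sqrt 3) by (apply sqrt_lt_R0; lra);
  unfold dot, sum4, normal_field, rotational_h, rotational_t, rotational,
    metric_h, metric_t;
  field_simplify_eq; try (repeat split; lra);
  ring [Hr2 Hp sqrt3_sqr (cos2_eq u) (cos2_eq v)].

Lemma dot_position K y p psi s h t :
  profile K y p psi s -> dot (rotational K y psi) (rotational K y psi) h t = 1.
Proof. intros H. inner_products H h (psi h) (K * t). Qed.

Lemma dot_normal K y p psi s h t :
  profile K y p psi s -> dot (normal_field K y p psi) (normal_field K y p psi) h t = 1.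
Proof. intros H. inner_products H h (psi h) (K * t). Qed.

Lemma dot_normal_position K y p psi s h t :
  profile K y p psi s -> dot (normal_field K y p psi) (rotational K y psi) h t = 0.
Proof. intros H. inner_products H h (psi h) (K * t). Qed.

Lemma dot_h_position K y p psi s h t :
  profile K y p psi s -> dot (rotational_h K y p psi s) (rotational K y psi) h t = 0.
Proof. intros H. inner_products H h (psi h) (K * t). Qed.

Lemma dot_h_normal K y p psi s h t :
  profile K y p psi s -> dot (rotational_h K y p psi s) (normal_field K y p psi) h t = 0.
Proof. intros H. inner_products H h (psi h) (K * t). Qed.

Lemma dot_t_position K y p psi s h t :
  profile K y p psi s -> dot (rotational_t K y) (rotational K y psi) h t = 0.
Proof. intros H. inner_products H h (psi h) (K * t). Qed.

Lemma dot_t_normal K y p psi s h t :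
  profile K y p psi s -> dot (rotational_t K y) (normal_field K y p psi) h t = 0.
Proof. intros H. inner_products H h (psi h) (K * t). Qed.

Lemma dot_h_h K y p psi s h t :
  profile K y p psi s ->
  dot (rotational_h K y p psi s) (rotational_h K y p psi s) h t = metric_h y s h.
Proof. intros H. inner_products H h (psi h) (K * t). Qed.

Lemma dot_h_t K y p psi s h t :
  profile K y p psi s ->
  dot (rotational_h K y p psi s) (rotational_t K y) h t = 0.
Proof. intros H. inner_products H h (psi h) (K * t). Qed.

Lemma dot_t_t K y p psi s h t :
  profile K y p psi s ->
  dot (rotational_t K y) (rotational_t K y) h t = metric_t y h.
Proof. intros H. inner_products H h (psi h) (K * t). Qed.

(** Bootstrapping: the right-hand sides of the system are of class C^n when the
    unknowns are, so the unknowns are then of class C^(n+1). *)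
Lemma profile_smooth K y p psi s :
  profile K y p psi s ->
  (forall n, Cn n y -> Cn n p -> Cn n s) ->
  forall n, Cn n y /\ Cn n p /\ Cn n psi /\ Cn n s.
Proof.
  intros [HK Hy Hs Hr' Hp Hdy Hdp Hdps] Hcs.
  assert (Hyp : forall n, Cn n y /\ Cn n p).
  { induction n as [|n [IHy IHp]].
    - split; intros x; apply @ex_derive_continuous; eexists;
        [apply Hdy | apply Hdp].
    - pose proof (Hcs n IHy IHp) as IHs. split.
      + apply (Cn_of_derive n _ _ Hdy).
        apply Cn_mult; [|apply Cn_const].
        apply Cn_mult; auto. apply Cn_mult; auto. now apply Cn_pow.
      + apply (Cn_of_derive n _ _ Hdp).
        apply Cn_mult; [|apply Cn_const].
        apply Cn_mult; auto.
        apply Cn_minus; apply Cn_scal; now apply Cn_pow. }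
  intros n. destruct (Hyp n) as [Cy Cp]. repeat split; auto.
  apply Cn_S. apply (Cn_of_derive n _ _ Hdps).
  apply Cn_div.
  - intros x. apply Rgt_not_eq, Hr'.
  - apply Cn_mult; auto. apply Cn_scal. now apply Cn_pow.
  - apply Cn_minus; [|apply Cn_const]. apply Cn_scal. now apply Cn_pow.
Qed.

Theorem biconservative_rotational K y p psi s :
  profile K y p psi s ->
  (forall n, Cn n y -> Cn n p -> Cn n s) ->
  biconservative_immersion_S3 (diag_field (metric_h y s) (metric_t y))
    (rotational K y psi).
Proof.
  intros H Hcs.
  pose proof (profile_smooth _ _ _ _ _ H Hcs) as Hsm.
  assert (Cy : forall n, Cn n y) by (intros; apply Hsm).
  assert (Cps : forall n, Cn n psi) by (intros; apply Hsm).
  assert (Cs : forall n, Cn n s) by (intros; apply Hsm).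
  pose proof (profile_K _ _ _ _ _ H) as HK.
  pose proof (profile_y _ _ _ _ _ H) as Hy.
  assert (H3 : 0 < sqrt 3) by (apply sqrt_lt_R0; lra).
  assert (Hn : forall h, y h ^ 6 <> 0)
    by (intros h; apply Rgt_not_eq; now apply pow_lt).
  assert (Hn3 : forall h, K * y h ^ 3 <> 0)
    by (intros h; apply Rgt_not_eq, Rmult_lt_0_compat; auto; now apply pow_lt).
  assert (Ph : forall a, pd ch (rotational K y psi a) = rotational_h K y p psi s a).
  { intros a. do 2 (apply functional_extensionality; intros).
    now apply pd_ch_rotational. }
  assert (Pt : forall a, pd cth (rotational K y psi a) = rotational_t K y a).
  { intros a. do 2 (apply functional_extensionality; intros).
    now apply pd_cth_rotational with p s. }
  assert (Ph4 : pd4 ch (rotational K y psi) = rotational_h K y p psi s)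
    by (apply functional_extensionality; intros a; apply Ph).
  assert (Pt4 : pd4 cth (rotational K y psi) = rotational_t K y)
    by (apply functional_extensionality; intros a; apply Pt).
  assert (Ck1 : forall n, Cn n (curvature_h y)).
  { intros n. apply Cn_mult; [now apply Cn_pow | apply Cn_const]. }
  apply biconservative_of_fundamental_equations
    with (curvature_h y) (curvature_t y) (normal_field K y p psi); auto.
  - intros n. apply Cn_mult; [apply Cn_scal|]; now apply Cn_pow.
  - intros n. apply Cn_inv; auto. now apply Cn_pow.
  - intros n. replace (curvature_t y) with (fun h => -3 * curvature_h y h).
    + now apply Cn_scal.
    + apply functional_extensionality; intros h.
      unfold curvature_h, curvature_t. field. lra.
  - intros h. unfold metric_h.
    pose proof (profile_s _ _ _ _ _ H h).
    apply Rmult_lt_0_compat; [|now apply pow_lt].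
    apply Rmult_lt_0_compat; [lra | now apply pow_lt].
  - intros h. apply Rinv_0_lt_compat. now apply pow_lt.
  - assert (Crho : forall n, Cn n (fun h => rho K y h / (K * y h ^ 3))).
    { intros n. apply Cn_div; auto.
      - apply Cn_sqrt; [apply H|].
        apply Cn_minus; [|apply Cn_const]. apply Cn_scal; now apply Cn_pow.
      - apply Cn_scal; now apply Cn_pow. }
    assert (Cr : forall n, Cn n (fun h => 1 / (K * y h ^ 3))).
    { intros n. apply Cn_div; auto; [apply Cn_const|].
      apply Cn_scal; now apply Cn_pow. }
    intros a; destruct a.
    + apply (smooth_of_h (fun h => rho K y h / (K * y h ^ 3) * cos (psi h))).
      intros n. apply Cn_mult; auto. now apply Cn_cos.
    + apply (smooth_of_h (fun h => rho K y h / (K * y h ^ 3) * sin (psi h))).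
      intros n. apply Cn_mult; auto. now apply Cn_sin.
    + apply (smooth_prod (fun h => 1 / (K * y h ^ 3)) (fun t => cos (K * t))); auto.
      intros n. apply Cn_cos, Cn_scal, Cn_id.
    + apply (smooth_prod (fun h => 1 / (K * y h ^ 3)) (fun t => sin (K * t))); auto.
      intros n. apply Cn_sin, Cn_scal, Cn_id.
  - intros h t. now apply dot_position with p s.
  - intros i j h t. destruct i, j; rewrite ?Ph4, ?Pt4; simpl.
    + now apply dot_h_h.
    + now apply dot_h_t.
    + rewrite dot_comm. now apply dot_h_t.
    + now apply dot_t_t with p psi s.
  - intros i h t. destruct i; rewrite ?Ph4, ?Pt4.
    + now apply dot_h_position.
    + now apply dot_t_position with p s.
  - intros h t. now apply dot_normal with s.
  - intros h t. now apply dot_normal_position with s.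
  - intros i h t. destruct i; rewrite ?Ph4, ?Pt4.
    + now apply dot_h_normal.
    + now apply dot_t_normal with s.
  - intros a h t. rewrite Ph.
    apply (pd_ch (rotational_h K y p psi s a)), gauss_hh; auto. apply (Cs 1%nat).
  - intros a h t. rewrite Ph, Pt.
    apply (pd_cth (rotational_t K y a)), gauss_tt; auto.
  - intros a h t. rewrite Ph. now apply is_derive_normal_h.
  - intros a h t. rewrite Pt. now apply is_derive_normal_t with s.
  - intros h. unfold curvature_h, curvature_t. field. lra.
  - intros h. rewrite (Derive_metric_t K y p psi s h H).
    pose proof (profile_dy _ _ _ _ _ H h) as Hdy.
    specialize (Hy h).
    rewrite (is_derive_unique (curvature_h y) h
      (4 * y h ^ 7 * p h * s h / (9 * sqrt 3))).
    + unfold curvature_h, metric_t. field. lra.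
    + unfold curvature_h. derive_known. field. lra.
Qed.
(** * Increasing bijections of the line *)

(** The bound [m <= W] gives [H] at least linear growth, hence surjectivity, and
    makes the inverse Lipschitz, which turns the difference quotients of [H]
    into those of the inverse. *)
Lemma exists_inverse (H W : R -> R) m :
  0 < m -> (forall u, is_derive H u (W u)) -> (forall u, m <= W u) ->
  exists U : R -> R,
    (forall u, U (H u) = u) /\ (forall h, H (U h) = h) /\
    (forall h, is_derive U h (/ W (U h))).
Proof.
  intros Hm Hd HW.
  assert (Hgrow : forall a b, a <= b -> m * (b - a) <= H b - H a).
  { intros a b Hab.
    destruct (MVT_gen H a b W) as [c [_ Hc]].
    - intros x _. apply Hd.
    - intros x _. apply continuity_pt_filterlim.
      apply @ex_derive_continuous. eexists; apply Hd.
    - rewrite Hc. apply Rmult_le_compat_r; [lra | apply HW]. }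
  assert (Hinj : forall a b, H a = H b -> a = b).
  { intros a b Hab. destruct (Rtotal_order a b) as [l | [e | l]]; auto; exfalso;
      [pose proof (Hgrow a b) | pose proof (Hgrow b a)]; nra. }
  assert (Hsurj : forall h, exists u, H u = h).
  { intros h.
    (* By the growth bound [H] reaches [h] within this distance of 0. *)
    set (r := Rabs (h - H 0) / m).
    assert (Hr : 0 <= r)
      by (apply Rdiv_le_0_compat; [apply Rabs_pos | auto]).
    assert (Hmr : m * r = Rabs (h - H 0)) by (unfold r; field; lra).
    pose proof (Hgrow 0 r Hr). pose proof (Hgrow (- r) 0).
    pose proof (Rle_abs (h - H 0)). pose proof (Rle_abs (- (h - H 0))).
    rewrite Rabs_Ropp in *.
    destruct (IVT_gen H (- r) r h) as [u [_ Hu]].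
    - intros x. apply continuity_pt_filterlim.
      apply @ex_derive_continuous. eexists; apply Hd.
    - rewrite Rmin_left, Rmax_right; lra.
    - now exists u. }
  set (U := (fun h => iota (fun u : R => H u = h)) : R -> R).
  exists U.
  assert (HU : forall u, U (H u) = u).
  { intros u. apply (iota_unique (V := R_CompleteNormedModule)); auto. }
  assert (UH : forall h, H (U h) = h).
  { intros h. destruct (Hsurj h) as [u <-]. now rewrite HU. }
  split; [exact HU | split; [exact UH|]].
  intros h. apply is_derive_Reals. intros eps Heps.
  set (u := U h : R).
  assert (HWu : W u <> 0) by (pose proof (HW u); lra).
  assert (Hc : continuity_pt Rinv (W u)).
  { apply continuity_pt_filterlim. now apply continuous_Rinv. }
  pose proof (proj1 (continuity_pt_locally Rinv (W u)) Hc) as Hc'.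
  destruct (Hc' (mkposreal eps Heps)) as [e1 He1].
  destruct (proj1 (is_derive_Reals H u (W u)) (Hd u) e1 (cond_pos e1)) as [d1 Hd1].
  assert (Hpos : 0 < m * d1) by (apply Rmult_lt_0_compat; auto; apply cond_pos).
  exists (mkposreal _ Hpos). intros k Hk Hkd; simpl in Hkd.
  set (v := U (h + k) : R).
  assert (Hv : H v - H u = k) by (unfold v, u; rewrite !UH; ring).
  assert (Huv : v - u <> 0).
  { intros E. apply Hk. rewrite <- Hv. replace v with u by lra. ring. }
  assert (Hsmall : Rabs (v - u) < d1).
  { apply (Rmult_lt_reg_l m); auto. apply Rle_lt_trans with (Rabs k); auto.
    rewrite <- Hv.
    destruct (Rle_dec u v) as [l | l].
    - pose proof (Hgrow u v l).
      rewrite !Rabs_pos_eq; nra.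
    - pose proof (Hgrow v u). rewrite !Rabs_left; nra. }
  specialize (Hd1 (v - u) Huv Hsmall).
  replace (u + (v - u)) with v in Hd1 by ring. rewrite Hv in Hd1.
  specialize (He1 _ Hd1). simpl in He1.
  replace ((v - u) / k) with (/ (k / (v - u))) by (field; auto).
  exact He1.
Qed.

(** * Primitives of even 2 pi-periodic functions *)

(** The point of the k-th interval [k pi, (k+1) pi] that has the same cosine as
    [v] in [0, pi]. *)
Definition zigzag (k : Z) (v : R) : R :=
  if Z.even k then IZR k * PI + v else IZR (k + 1) * PI - v.

Lemma cos_plus_2PI x : cos (x + 2 * PI) = cos x.
Proof. rewrite <- (cos_period x 1). f_equal. simpl. ring. Qed.

Lemma cos_period_Z (j : Z) v : cos (2 * IZR j * PI + v) = cos v.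
Proof.
  revert j; apply (Z.peano_ind (fun j => cos (2 * IZR j * PI + v) = cos v)).
  - f_equal. ring.
  - intros j <-. rewrite succ_IZR.
    replace (2 * (IZR j + 1) * PI + v) with (2 * IZR j * PI + v + 2 * PI) by ring.
    apply cos_plus_2PI.
  - intros j <-. unfold Z.pred. rewrite plus_IZR.
    rewrite <- cos_plus_2PI. f_equal. simpl. ring.
Qed.

Lemma even_IZR k : Z.even k = true -> exists j, IZR k = 2 * IZR j.
Proof.
  intros Hk. apply Z.even_spec in Hk. destruct Hk as [j ->].
  exists j. now rewrite mult_IZR.
Qed.

Lemma odd_IZR k : Z.even k = false -> exists j, IZR k = 2 * IZR j + 1.
Proof.
  intros Hk. rewrite <- Z.negb_odd in Hk. apply Bool.negb_false_iff in Hk.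
  apply Z.odd_spec in Hk. destruct Hk as [j ->].
  exists j. now rewrite plus_IZR, mult_IZR.
Qed.

Lemma cos_zigzag k v : cos (zigzag k v) = cos v.
Proof.
  unfold zigzag. destruct (Z.even k) eqn:Hk.
  - destruct (even_IZR k Hk) as [j ->]. apply cos_period_Z.
  - destruct (odd_IZR k Hk) as [j Hj]. rewrite plus_IZR, Hj.
    replace ((2 * IZR j + 1 + 1) * PI - v) with (2 * IZR (j + 1) * PI + - v)
      by (rewrite plus_IZR; ring).
    rewrite cos_period_Z. apply cos_neg.
Qed.

Lemma eq_of_derive_0 (f : R -> R) a b : (forall x, is_derive f x 0) -> f a = f b.
Proof.
  intros Hf. destruct (Rtotal_order a b) as [l | [-> | l]]; auto.
  - apply (eq_is_derive f a b); auto.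
  - symmetry. apply (eq_is_derive f b a); auto.
Qed.

(** A primitive [P] of an even 2 pi-periodic function satisfies
    [P (- u) = 2 P 0 - P u] and [P (u + 2 pi) = P u + 2 (P pi - P 0)]; iterating
    the two symmetries gives the alternating pattern of the branches [h_k]. *)
Lemma primitive_zigzag (P w : R -> R) k v :
  (forall u, is_derive P u (w u)) ->
  (forall u u', cos u = cos u' -> w u = w u') ->
  P (zigzag k v) =
  if Z.even k then IZR k * (P PI - P 0) + P v
  else IZR (k + 1) * P PI - IZR (k - 1) * P 0 - P v.
Proof.
  intros Hd Hw.
  assert (Hneg : forall u, P (- u) = 2 * P 0 - P u).
  { intros u.
    assert (E : P (- u) + P u = P (- 0) + P 0).
    { apply (eq_of_derive_0 (fun u => P (- u) + P u)). intros x.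
      replace 0 with (- w (- x) + w x).
      - pose proof (Hd x). pose proof (Hd (- x)).
        auto_derive; [repeat split; eexists; eauto|].
        change (Derive (fun x => P x)) with (Derive P).
        rewrite (is_derive_unique P x (w x)), (is_derive_unique P (- x) (w (- x))); auto.
        ring.
      - rewrite (Hw (- x) x); [ring | apply cos_neg]. }
    rewrite Ropp_0 in E. lra. }
  assert (Hper : forall u, P (u + 2 * PI) = P u + 2 * (P PI - P 0)).
  { intros u.
    assert (E : P (u + 2 * PI) - P u = P (- PI + 2 * PI) - P (- PI)).
    { apply (eq_of_derive_0 (fun u => P (u + 2 * PI) - P u)). intros x.
      replace 0 with (w (x + 2 * PI) - w x).
      - pose proof (Hd x). pose proof (Hd (x + 2 * PI)).
        auto_derive; [repeat split; eexists; eauto|].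
        change (Derive (fun x => P x)) with (Derive P).
        rewrite (is_derive_unique P x (w x)),
          (is_derive_unique P (x + 2 * PI) (w (x + 2 * PI))); auto.
        ring.
      - rewrite (Hw (x + 2 * PI) x); [ring|].
        apply cos_plus_2PI. }
    rewrite Hneg in E. replace (- PI + 2 * PI) with PI in E by ring. lra. }
  assert (Hshift : forall j u, P (2 * IZR j * PI + u) = 2 * IZR j * (P PI - P 0) + P u).
  { intros j u; revert j.
    apply (Z.peano_ind (fun j => P (2 * IZR j * PI + u) = 2 * IZR j * (P PI - P 0) + P u)).
    - replace (2 * 0 * PI + u) with u by ring. ring.
    - intros j IH. rewrite succ_IZR.
      replace (2 * (IZR j + 1) * PI + u) with (2 * IZR j * PI + u + 2 * PI) by ring.
      rewrite Hper, IH. ring.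
    - intros j IH. unfold Z.pred. rewrite plus_IZR.
      replace (2 * IZR j * PI + u) with (2 * (IZR j + -1) * PI + u + 2 * PI) in IH by ring.
      rewrite Hper in IH. lra. }
  unfold zigzag. destruct (Z.even k) eqn:Hk.
  - destruct (even_IZR k Hk) as [j ->]. apply Hshift.
  - destruct (odd_IZR k Hk) as [j Hj]. rewrite plus_IZR, minus_IZR, Hj.
    replace ((2 * IZR j + 1 + 1) * PI - v) with (2 * IZR (j + 1) * PI + - v)
      by (rewrite plus_IZR; ring).
    rewrite Hshift, Hneg, plus_IZR. ring.
Qed.

Lemma zigzag_surj u : exists k v, 0 <= v <= PI /\ u = zigzag k v.
Proof.
  pose proof PI_RGT_0 as Hpi.
  pose proof (base_Int_part (u / PI)) as [H1 H2].
  set (k := Int_part (u / PI)) in *.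
  assert (E : u = u / PI * PI) by (field; lra).
  assert (B : IZR k * PI <= u <= (IZR k + 1) * PI) by (split; nra).
  exists k. unfold zigzag. destruct (Z.even k).
  - exists (u - IZR k * PI). split; [lra | ring].
  - exists (IZR (k + 1) * PI - u). rewrite plus_IZR. split; [lra | ring].
Qed.

(** * Improper integrals by substitution *)

(** A point [x] slightly to the right of [g a] is [g u] for some [u] close to
    [a], by the intermediate value theorem, and there [f x = P u].  No inverse of
    [g] is needed. *)
Lemma limit_by_substitution (f g P : R -> R) a b :
  a < b -> (forall u, continuous g u) -> continuous P a ->
  (forall u, a < u < b -> f (g u) = P u) ->
  (forall u, a < u < b -> g a < g u) ->
  forall eps : posreal, exists d : posreal,
    forall x, g a < x < g a + d -> Rabs (f x - P a) < eps.
Proof.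
  intros Hab Hg HP Hf Hmon eps.
  destruct (proj1 (filterlim_locally P (P a)) HP eps) as [e He].
  set (c := a + Rmin e (b - a) / 2).
  assert (Hm : 0 < Rmin e (b - a)) by (apply Rmin_pos; [apply cond_pos | lra]).
  pose proof (Rmin_l e (b - a)). pose proof (Rmin_r e (b - a)).
  assert (Hc : a < c < b) by (unfold c; lra).
  pose proof (Hmon c Hc) as Hgc.
  assert (Hd : 0 < g c - g a) by lra.
  exists (mkposreal _ Hd). simpl. intros x Hx.
  destruct (IVT_gen g a c x) as [u [Hu Hgu]].
  - intros z. apply continuity_pt_filterlim, Hg.
  - rewrite Rmin_left, Rmax_right; lra.
  - rewrite Rmin_left, Rmax_right in Hu by lra.
    assert (Hua : u <> a) by (intros ->; lra).
    rewrite <- Hgu, Hf by lra.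
    apply (He u). change (Rabs (u - a) < e).
    rewrite Rabs_pos_eq; unfold c in *; lra.
Qed.

Lemma lim_right_by_substitution (f g P : R -> R) a b :
  a < b -> (forall u, continuous g u) -> continuous P a ->
  (forall u, a < u < b -> f (g u) = P u) ->
  (forall u, a < u < b -> g a < g u) ->
  lim_right f (g a) = P a.
Proof.
  intros Hab Hg HP Hf Hmon.
  apply (iota_filterlim_locally (V := R_CompleteNormedModule)).
  apply filterlim_locally. intros eps.
  destruct (limit_by_substitution f g P a b Hab Hg HP Hf Hmon eps) as [d Hd].
  exists d. intros x Hx Hax. apply Hd.
  apply Rabs_lt_between' in Hx. lra.
Qed.

Lemma lim_left_by_substitution (f g P : R -> R) a b :
  a < b -> (forall u, continuous g u) -> continuous P b ->
  (forall u, a < u < b -> f (g u) = P u) ->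
  (forall u, a < u < b -> g u < g b) ->
  lim_left f (g b) = P b.
Proof.
  intros Hab Hg HP Hf Hmon.
  apply (iota_filterlim_locally (V := R_CompleteNormedModule)).
  apply filterlim_locally. intros eps.
  (* The reflection [x -> - x] exchanges left and right limits. *)
  destruct (limit_by_substitution (fun x => f (- x)) (fun u => - g (- u))
    (fun u => P (- u)) (- b) (- a)) with (eps := eps) as [d Hd].
  - lra.
  - intros u. apply (continuous_opp (V := R_NormedModule) (fun u => g (- u))).
    apply (continuous_comp Ropp g); [|apply Hg].
    apply (continuous_opp (V := R_NormedModule)), continuous_id.
  - apply (continuous_comp Ropp P); [|now rewrite Ropp_involutive].
    apply (continuous_opp (V := R_NormedModule)), continuous_id.
  - intros u Hu. rewrite Ropp_involutive. apply Hf. lra.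
  - intros u Hu. rewrite Ropp_involutive. apply Ropp_lt_contravar, Hmon. lra.
  - rewrite Ropp_involutive in Hd.
    exists d. intros x Hx Hax.
    replace (f x) with (f (- - x)) by (f_equal; ring). apply Hd.
    apply Rabs_lt_between' in Hx. lra.
Qed.

(** The integrand [k] may be singular at [g a] and [g b], while [w] extends
    continuously. *)
Lemma RInt_by_substitution (k g g' w : R -> R) a b u0 u :
  (forall v, is_derive g v (g' v)) -> (forall v, continuous g' v) ->
  (forall v, a < v < b -> continuous k (g v)) ->
  (forall v, a < v < b -> g' v * k (g v) = w v) ->
  a < u0 < b -> a < u < b ->
  RInt k (g u0) (g u) = RInt w u0 u.
Proof.
  intros Hg Hg' Hk Hw H0 H.
  assert (B : forall v, Rmin u0 u <= v <= Rmax u0 u -> a < v < b).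
  { intros v. unfold Rmin, Rmax. destruct (Rle_dec u0 u); lra. }
  rewrite <- (RInt_comp k g g' u0 u).
  - apply RInt_ext. intros v Hv. apply Hw, B. lra.
  - intros v Hv. apply Hk, B, Hv.
  - intros v Hv. split; auto.
Qed.

Lemma is_derive_primitive (w : R -> R) u0 u :
  (forall v, continuous w v) -> is_derive (RInt w u0) u (w u).
Proof.
  intros Hw. apply (is_derive_RInt w (RInt w u0) u0 u); auto.
  exists (mkposreal 1 Rlt_0_1). intros v _.
  apply (RInt_correct (V := R_CompleteNormedModule)).
  apply (ex_RInt_continuous (V := R_CompleteNormedModule)). auto.
Qed.
(** * The quartic in x = xi^(2/3) *)

Definition quartic (C x : R) : R := - x ^ 4 + 3 * C * x ^ 3 - 3.

(** The quotient of the quartic by [(x - x1) (x2 - x)], with coefficients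
    expressed through the roots so that its positivity is visible. *)
Definition cofactor (x1 x2 x : R) : R :=
  x ^ 2 + 3 * (x1 + x2) / (x1 * x2) ^ 2 * x + 3 / (x1 * x2).

(** The last condition says that the metric is positive definite; it is how the
    bound on [Cs] is used. *)
Record admissible (C Cs x1 x2 : R) : Prop := {
  adm_x1 : 0 < x1;
  adm_x12 : x1 < x2;
  adm_root1 : quartic C x1 = 0;
  adm_root2 : quartic C x2 = 0;
  adm_Cs : forall x, 0 < x -> 0 < 3 * x ^ 3 - Cs ^ 2 * quartic C x
}.

(** Eliminating [C] from the two root equations gives
    [(x1 x2)^3 = 3 (x1^2 + x1 x2 + x2^2)], which is what makes the coefficients
    match. *)
Lemma quartic_factor C x1 x2 x :
  0 < x1 < x2 -> quartic C x1 = 0 -> quartic C x2 = 0 ->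
  quartic C x = (x - x1) * (x2 - x) * cofactor x1 x2 x.
Proof.
  intros [H1 H12] E1 E2.
  assert (C1 : C = (x1 ^ 4 + 3) / (3 * x1 ^ 3)).
  { apply (Rmult_eq_reg_r (3 * x1 ^ 3)).
    - unfold quartic in E1. field_simplify; [lra | lra].
    - apply Rgt_not_eq. assert (0 < x1 ^ 3) by (now apply pow_lt). lra. }
  assert (P3 : (x1 * x2) ^ 3 = 3 * (x1 ^ 2 + x1 * x2 + x2 ^ 2)).
  { apply (Rmult_eq_reg_r (x2 - x1)); [|lra].
    assert (E : x1 ^ 3 * quartic C x2 - x2 ^ 3 * quartic C x1 = 0)
      by (rewrite E1, E2; ring).
    unfold quartic in E. nra. }
  assert (P : x1 * x2 <> 0) by nra.
  assert (Hq : cofactor x1 x2 x * (x1 * x2) ^ 2 =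
     x ^ 2 * (x1 * x2) ^ 2 + 3 * (x1 + x2) * x + 3 * (x1 * x2))
    by (unfold cofactor; field; lra).
  apply (Rmult_eq_reg_r ((x1 * x2) ^ 2 * (3 * x1 ^ 3))).
  2: { apply Rgt_not_eq. assert (0 < x1 ^ 3) by (now apply pow_lt).
       assert (0 < (x1 * x2) ^ 2) by (apply pow_lt; nra). nra. }
  transitivity ((x - x1) * (x2 - x) * (cofactor x1 x2 x * (x1 * x2) ^ 2) * (3 * x1 ^ 3));
    [|ring].
  rewrite Hq. unfold quartic. rewrite C1. field_simplify; [|lra].
  rewrite Rpow_mult_distr in P3. ring [P3].
Qed.

Lemma cofactor_pos x1 x2 x : 0 < x1 < x2 -> 0 < x -> 0 < cofactor x1 x2 x.
Proof.
  intros H Hx. unfold cofactor.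
  assert (P : 0 < x1 * x2) by nra.
  assert (0 < x ^ 2) by (now apply pow_lt).
  assert (0 < 3 * (x1 + x2) / (x1 * x2) ^ 2)
    by (apply Rdiv_lt_0_compat; [lra | now apply pow_lt]).
  assert (0 < 3 / (x1 * x2)) by (apply Rdiv_lt_0_compat; lra).
  nra.
Qed.

(** By Rolle's theorem the critical point [9 C / 4] separates the roots. *)
Lemma critical_point_between C x1 x2 :
  0 < x1 < x2 -> quartic C x1 = 0 -> quartic C x2 = 0 -> x1 < 9 / 4 * C < x2.
Proof.
  intros [H1 H12] E1 E2.
  destruct (MVT_cor2 (quartic C) (fun x => x ^ 2 * (9 * C - 4 * x)) x1 x2 H12)
    as [c [Hc Hc12]].
  - intros c _. apply is_derive_Reals. unfold quartic. auto_derive; auto. ring.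
  - rewrite E1, E2 in Hc.
    assert (0 < c ^ 2) by (apply pow_lt; lra).
    assert (E : 9 * C - 4 * c = 0).
    { apply (Rmult_eq_reg_l (c ^ 2 * (x2 - x1))); [nra|].
      apply Rgt_not_eq. nra. }
    lra.
Qed.

Lemma Rpower_pow3 y a n :
  0 < y -> 3 * a = INR n -> Rpower (y ^ 3) a = y ^ n.
Proof.
  intros Hy E. rewrite <- (Rpower_pow 3 y Hy), Rpower_mult, <- Rpower_pow by auto.
  f_equal. rewrite <- E. simpl. ring.
Qed.

Lemma T_cube C y : 0 < y -> T C (y ^ 3) = quartic C (y ^ 2).
Proof.
  intros Hy. unfold T, quartic.
  rewrite (Rpower_pow3 y (8 / 3) 8) by (auto; simpl; field). ring.
Qed.

(** The hypothesis on [Cs] makes the metric positive: with [a = sqrt 3],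
    [3 x^3 - Cs^2 quartic] is [3 x^3 (1 - Cs^2 (C - 4 / 3^(3/2)))] plus
    [Cs^2 (x - a)^2 (x^2 + 2/a x + 1)]. *)
Lemma metric_denominator_pos C Cs x :
  C > 4 / Rpower 3 (3 / 2) ->
  0 < Cs < Rpower (C - 4 / Rpower 3 (3 / 2)) (- (1 / 2)) ->
  0 < x -> 0 < 3 * x ^ 3 - Cs ^ 2 * quartic C x.
Proof.
  intros HC [Hs0 Hs] Hx.
  set (a := sqrt 3).
  assert (Ha : 0 < a) by (apply sqrt_lt_R0; lra).
  assert (Ha2 : a ^ 2 = 3) by (apply pow2_sqrt; lra).
  assert (Hr : Rpower 3 (3 / 2) = 3 * a).
  { replace (3 / 2) with (1 + / 2) by field.
    rewrite Rpower_plus, Rpower_1, Rpower_sqrt by lra. reflexivity. }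
  rewrite Hr in *.
  set (e := C - 4 / (3 * a)) in *.
  assert (He : 0 < e) by (unfold e; lra).
  assert (Hse : Cs ^ 2 * e < 1).
  { rewrite Rpower_Ropp in Hs. replace (1 / 2) with (/ 2) in Hs by field.
    rewrite Rpower_sqrt in Hs by auto.
    assert (Hq : 0 < sqrt e) by (now apply sqrt_lt_R0).
    assert (Hq2 : sqrt e ^ 2 = e) by (apply pow2_sqrt; lra).
    assert (Hp : Cs * sqrt e < 1).
    { apply (Rmult_lt_compat_r (sqrt e)) in Hs; auto.
      rewrite Rinv_l in Hs; lra. }
    rewrite <- Hq2. assert (0 < Cs * sqrt e) by nra. nra. }
  replace (3 * x ^ 3 - Cs ^ 2 * quartic C x) with
    (3 * x ^ 3 * (1 - Cs ^ 2 * e)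
     + Cs ^ 2 * ((x - a) ^ 2 * (x ^ 2 + 2 / a * x + 1))).
  - assert (0 < x ^ 3) by (now apply pow_lt).
    assert (0 < 2 / a) by (apply Rdiv_lt_0_compat; lra).
    apply Rplus_lt_le_0_compat.
    + apply Rmult_lt_0_compat; lra.
    + apply Rmult_le_pos; [apply pow2_ge_0|].
      apply Rmult_le_pos; [apply pow2_ge_0|]. nra.
  - unfold quartic, e. field_simplify_eq; [|lra]. ring [Ha2].
Qed.

(** * The uniformizing parameter *)

(** In the parameter [u] the oscillation of [x] between the roots is harmonic,
    and the square root of the quartic becomes [momentum], which is smooth
    through the turning points. *)
Definition xpath (x1 x2 u : R) : R := (x1 + x2) / 2 - (x2 - x1) / 2 * cos u.

Definition ypath (x1 x2 u : R) : R := sqrt (xpath x1 x2 u).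

Definition momentum (x1 x2 u : R) : R :=
  (x2 - x1) / 2 * sin u * sqrt (cofactor x1 x2 (xpath x1 x2 u)).

(** [dh / du] and [dzeta / du], as functions of [x]. *)
Definition h_speed (C Cs x1 x2 x : R) : R :=
  3 / 2 * sqrt (3 * x ^ 3 - Cs ^ 2 * quartic C x)
  / (sqrt x ^ 5 * sqrt (cofactor x1 x2 x)).

Definition zeta_speed (C x1 x2 x : R) : R :=
  3 / 2 * sqrt C * sqrt x ^ 5 / ((C * x ^ 3 - 1) * sqrt (cofactor x1 x2 x)).

Lemma xpath_bounds x1 x2 u : 0 < x1 < x2 -> x1 <= xpath x1 x2 u <= x2.
Proof. intros H. unfold xpath. pose proof (COS_bound u). nra. Qed.

Lemma ypath_pos x1 x2 u : 0 < x1 < x2 -> 0 < ypath x1 x2 u.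
Proof. intros H. apply sqrt_lt_R0. pose proof (xpath_bounds x1 x2 u H). lra. Qed.

Lemma ypath_sqr x1 x2 u : 0 < x1 < x2 -> ypath x1 x2 u ^ 2 = xpath x1 x2 u.
Proof. intros H. apply pow2_sqrt. pose proof (xpath_bounds x1 x2 u H). lra. Qed.

Lemma momentum_sqr C x1 x2 u :
  0 < x1 < x2 -> quartic C x1 = 0 -> quartic C x2 = 0 ->
  momentum x1 x2 u ^ 2 = quartic C (xpath x1 x2 u).
Proof.
  intros H E1 E2. rewrite (quartic_factor C x1 x2) by auto.
  unfold momentum. rewrite !Rpow_mult_distr, pow2_sqrt.
  - generalize (cofactor x1 x2 (xpath x1 x2 u)); intros q. unfold xpath.
    field_simplify_eq. ring [(cos2_eq u)].
  - left. apply cofactor_pos; auto. pose proof (xpath_bounds x1 x2 u H). lra.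
Qed.

Lemma quartic_nonneg C x1 x2 x :
  0 < x1 < x2 -> quartic C x1 = 0 -> quartic C x2 = 0 -> x1 <= x <= x2 ->
  0 <= quartic C x.
Proof.
  intros H E1 E2 Hx. rewrite (quartic_factor C x1 x2) by auto.
  pose proof (cofactor_pos x1 x2 x H).
  apply Rmult_le_pos; [nra | lra].
Qed.

Lemma C_cube_gt_1 C x1 x2 x :
  0 < x1 < x2 -> quartic C x1 = 0 -> quartic C x2 = 0 -> x1 <= x <= x2 ->
  1 < C * x ^ 3.
Proof.
  intros H E1 E2 Hx. pose proof (quartic_nonneg C x1 x2 x H E1 E2 Hx) as Hq.
  unfold quartic in Hq. assert (0 < x ^ 4) by (apply pow_lt; lra). lra.
Qed.
Lemma is_derive_xpath x1 x2 u :
  is_derive (xpath x1 x2) u ((x2 - x1) / 2 * sin u).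
Proof. unfold xpath. auto_derive; auto. field. Qed.

Lemma is_derive_ypath x1 x2 u :
  0 < x1 < x2 ->
  is_derive (ypath x1 x2) u ((x2 - x1) / 2 * sin u / (2 * ypath x1 x2 u)).
Proof.
  intros H. apply (is_derive_sqrt (xpath x1 x2)).
  - apply is_derive_xpath.
  - pose proof (xpath_bounds x1 x2 u H). lra.
Qed.

Lemma quartic_derivative_factor C x1 x2 x :
  0 < x1 < x2 -> quartic C x1 = 0 -> quartic C x2 = 0 ->
  9 * C * x ^ 2 - 4 * x ^ 3 =
  (x1 + x2 - 2 * x) * cofactor x1 x2 x
  + (x - x1) * (x2 - x) * (2 * x + 3 * (x1 + x2) / (x1 * x2) ^ 2).
Proof.
  intros H E1 E2.
  rewrite <- (is_derive_unique (quartic C) x (9 * C * x ^ 2 - 4 * x ^ 3)).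
  - rewrite (Derive_ext _ (fun x => (x - x1) * (x2 - x) * cofactor x1 x2 x))
      by (intros; now apply quartic_factor).
    apply is_derive_unique. unfold cofactor. auto_derive; auto. field. nra.
  - unfold quartic. auto_derive; auto. ring.
Qed.

(** Differentiating [momentum^2 = quartic (xpath u)] would give this only where
    [sin u <> 0]; the factorization of the quartic gives it everywhere. *)
Lemma is_derive_momentum C x1 x2 u :
  0 < x1 < x2 -> quartic C x1 = 0 -> quartic C x2 = 0 ->
  is_derive (momentum x1 x2) u
    ((9 * C * xpath x1 x2 u ^ 2 - 4 * xpath x1 x2 u ^ 3)
     / (2 * sqrt (cofactor x1 x2 (xpath x1 x2 u)))).
Proof.
  intros H E1 E2.
  pose proof (xpath_bounds x1 x2 u H).
  assert (Hq : 0 < cofactor x1 x2 (xpath x1 x2 u)) by (apply cofactor_pos; lra).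
  assert (Hr : 0 < sqrt (cofactor x1 x2 (xpath x1 x2 u))) by (now apply sqrt_lt_R0).
  rewrite (quartic_derivative_factor C x1 x2) by auto.
  pose (Q := fun v => cofactor x1 x2 (xpath x1 x2 v)).
  assert (HQ : is_derive Q u ((x2 - x1) / 2 * sin u *
    (2 * xpath x1 x2 u + 3 * (x1 + x2) / (x1 * x2) ^ 2))).
  { apply (is_derive_comp (cofactor x1 x2) (xpath x1 x2)).
    - unfold cofactor. auto_derive; auto. field. nra.
    - apply is_derive_xpath. }
  change (is_derive (fun v => (x2 - x1) / 2 * sin v * sqrt (Q v)) u
    (((x1 + x2 - 2 * xpath x1 x2 u) * Q u
      + (xpath x1 x2 u - x1) * (x2 - xpath x1 x2 u)
        * (2 * xpath x1 x2 u + 3 * (x1 + x2) / (x1 * x2) ^ 2))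
     / (2 * sqrt (Q u)))).
  change (0 < Q u) in Hq. change (0 < sqrt (Q u)) in Hr.
  clearbody Q.
  derive_known.
  pose proof (pow2_sqrt (Q u) (Rlt_le _ _ Hq)) as Hr2.
  generalize dependent (sqrt (Q u)); intros r Hr Hr2.
  unfold xpath. field_simplify_eq; [|repeat split; nra].
  ring [(cos2_eq u) Hr2].
Qed.

Lemma Cn_xpath x1 x2 n : Cn n (xpath x1 x2).
Proof. apply Cn_minus; [apply Cn_const|]. apply Cn_scal, Cn_cos, Cn_id. Qed.

Lemma Cn_sqrt_cofactor x1 x2 n :
  0 < x1 < x2 -> Cn n (fun u => sqrt (cofactor x1 x2 (xpath x1 x2 u))).
Proof.
  intros H. pose proof (Cn_xpath x1 x2 n) as Cx.
  apply (Cn_sqrt n (fun u => cofactor x1 x2 (xpath x1 x2 u))).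
  - intros u. apply cofactor_pos; auto. pose proof (xpath_bounds x1 x2 u H). lra.
  - apply Cn_plus; [|apply Cn_const]. apply Cn_plus; [now apply Cn_pow|].
    now apply Cn_scal.
Qed.

Lemma sqrt_cofactor_pos x1 x2 u :
  0 < x1 < x2 -> 0 < sqrt (cofactor x1 x2 (xpath x1 x2 u)).
Proof.
  intros H. apply sqrt_lt_R0, cofactor_pos; auto.
  pose proof (xpath_bounds x1 x2 u H). lra.
Qed.

Lemma Cn_ypath x1 x2 n : 0 < x1 < x2 -> Cn n (ypath x1 x2).
Proof.
  intros H. apply Cn_sqrt; [|apply Cn_xpath].
  intros u. pose proof (xpath_bounds x1 x2 u H). lra.
Qed.

Lemma Cn_h_speed C Cs x1 x2 n :
  admissible C Cs x1 x2 ->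
  Cn n (fun u => h_speed C Cs x1 x2 (xpath x1 x2 u)).
Proof.
  intros [H1 H12 _ _ Hs]. assert (H : 0 < x1 < x2) by lra.
  pose proof (Cn_xpath x1 x2 n) as Cx.
  apply Cn_div.
  - intros u. apply Rgt_not_eq, Rmult_lt_0_compat.
    + apply pow_lt, ypath_pos, H.
    + now apply sqrt_cofactor_pos.
  - apply Cn_scal.
    apply (Cn_sqrt n (fun u => 3 * xpath x1 x2 u ^ 3 - Cs ^ 2 * quartic C (xpath x1 x2 u))).
    + intros u. apply Hs. pose proof (xpath_bounds x1 x2 u H). lra.
    + apply Cn_minus; [apply Cn_scal; now apply Cn_pow|].
      apply Cn_scal. apply Cn_minus; [|apply Cn_const].
      apply Cn_plus; [|apply Cn_scal; now apply Cn_pow].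
      replace (fun u => - xpath x1 x2 u ^ 4) with (fun u => -1 * xpath x1 x2 u ^ 4)
        by (apply functional_extensionality; intros; ring).
      apply Cn_scal; now apply Cn_pow.
  - apply Cn_mult; [|now apply Cn_sqrt_cofactor].
    apply (Cn_pow n 5 (ypath x1 x2)). now apply Cn_ypath.
Qed.

Lemma Cn_zeta_speed C Cs x1 x2 n :
  admissible C Cs x1 x2 ->
  Cn n (fun u => zeta_speed C x1 x2 (xpath x1 x2 u)).
Proof.
  intros [H1 H12 E1 E2 _]. assert (H : 0 < x1 < x2) by lra.
  pose proof (Cn_xpath x1 x2 n) as Cx.
  apply Cn_div.
  - intros u. apply Rgt_not_eq, Rmult_lt_0_compat.
    + pose proof (C_cube_gt_1 C x1 x2 _ H E1 E2 (xpath_bounds x1 x2 u H)). lra.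
    + now apply sqrt_cofactor_pos.
  - apply Cn_scal. apply (Cn_pow n 5 (ypath x1 x2)). now apply Cn_ypath.
  - apply Cn_mult; [|now apply Cn_sqrt_cofactor].
    apply Cn_minus; [|apply Cn_const]. apply Cn_scal. now apply Cn_pow.
Qed.

Lemma h_speed_pos C Cs x1 x2 x :
  admissible C Cs x1 x2 -> 0 < x -> 0 < h_speed C Cs x1 x2 x.
Proof.
  intros [H1 H12 _ _ Hs] Hx. apply Rdiv_lt_0_compat.
  - assert (0 < sqrt (3 * x ^ 3 - Cs ^ 2 * quartic C x)) by (apply sqrt_lt_R0; auto).
    lra.
  - apply Rmult_lt_0_compat; [apply pow_lt|]; apply sqrt_lt_R0; auto.
    apply cofactor_pos; lra.
Qed.

(** By periodicity it is enough to bound the speed on one period. *)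
Lemma h_speed_lower_bound C Cs x1 x2 :
  admissible C Cs x1 x2 ->
  exists m, 0 < m /\ forall u, m <= h_speed C Cs x1 x2 (xpath x1 x2 u).
Proof.
  intros A. pose proof A as [H1 H12 _ _ _]. assert (H : 0 < x1 < x2) by lra.
  pose proof PI_RGT_0 as Hpi.
  destruct (continuity_ab_min (fun u => h_speed C Cs x1 x2 (xpath x1 x2 u)) 0 PI)
    as [um [Hmin _]].
  - lra.
  - intros u _. apply continuity_pt_filterlim. now apply (Cn_h_speed C Cs x1 x2 0).
  - exists (h_speed C Cs x1 x2 (xpath x1 x2 um)). split.
    + apply h_speed_pos; auto. pose proof (xpath_bounds x1 x2 um H). lra.
    + intros u. destruct (zigzag_surj u) as [k [v [Hv ->]]].
      unfold xpath at 2. rewrite cos_zigzag. now apply Hmin.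
Qed.
(** * The integrals h_0 and zeta_0 in the parameter u *)

Definition xi_path (x1 x2 u : R) : R := ypath x1 x2 u ^ 3.

Lemma is_derive_xi_path x1 x2 u :
  0 < x1 < x2 ->
  is_derive (xi_path x1 x2) u (3 / 2 * ypath x1 x2 u * ((x2 - x1) / 2 * sin u)).
Proof.
  intros H. pose proof (ypath_pos x1 x2 u H) as Hy.
  pose proof (is_derive_ypath x1 x2 u H) as Hd.
  unfold xi_path.
  generalize dependent (ypath x1 x2); intros y Hy Hd.
  derive_known. field. lra.
Qed.

Lemma Cn_xi_path x1 x2 n : 0 < x1 < x2 -> Cn n (xi_path x1 x2).
Proof. intros H. now apply Cn_pow, Cn_ypath. Qed.

Lemma Cn_xi_path_speed x1 x2 n :
  0 < x1 < x2 ->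
  Cn n (fun u => 3 / 2 * ypath x1 x2 u * ((x2 - x1) / 2 * sin u)).
Proof.
  intros H. apply Cn_mult; apply Cn_scal; [now apply Cn_ypath|].
  apply Cn_sin, Cn_id.
Qed.

Lemma xi_path_increasing x1 x2 u v :
  0 < x1 < x2 -> 0 <= u -> u < v -> v <= PI -> xi_path x1 x2 u < xi_path x1 x2 v.
Proof.
  intros H Hu Huv Hv.
  assert (Hx : xpath x1 x2 u < xpath x1 x2 v).
  { unfold xpath. assert (cos v < cos u) by (apply cos_decreasing_1; lra). nra. }
  assert (Hy : ypath x1 x2 u < ypath x1 x2 v).
  { apply sqrt_lt_1; auto; pose proof (xpath_bounds x1 x2 u H);
      pose proof (xpath_bounds x1 x2 v H); lra. }
  pose proof (ypath_pos x1 x2 u H). unfold xi_path. simpl.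
  assert (ypath x1 x2 u * ypath x1 x2 u < ypath x1 x2 v * ypath x1 x2 v) by nra.
  nra.
Qed.

Lemma xi_path_zigzag x1 x2 k v : xi_path x1 x2 (zigzag k v) = xi_path x1 x2 v.
Proof. unfold xi_path, ypath, xpath. now rewrite cos_zigzag. Qed.

Lemma T_xi_path C x1 x2 u :
  0 < x1 < x2 -> T C (xi_path x1 x2 u) = quartic C (xpath x1 x2 u).
Proof.
  intros H. unfold xi_path. rewrite T_cube by (now apply ypath_pos).
  now rewrite ypath_sqr.
Qed.

Lemma sqrt_quartic C x1 x2 u :
  0 < x1 < x2 -> quartic C x1 = 0 -> quartic C x2 = 0 -> 0 < u < PI ->
  0 < momentum x1 x2 u /\ sqrt (quartic C (xpath x1 x2 u)) = momentum x1 x2 u.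
Proof.
  intros H E1 E2 Hu.
  assert (Hp : 0 < momentum x1 x2 u).
  { apply Rmult_lt_0_compat; [|now apply sqrt_cofactor_pos].
    apply Rmult_lt_0_compat; [lra | apply sin_gt_0; lra]. }
  split; auto.
  rewrite <- (momentum_sqr C x1 x2 u) by auto. apply sqrt_pow2. lra.
Qed.

Definition h_integrand (C Cs tau : R) : R :=
  sqrt ((3 * tau ^ 2 - Cs ^ 2 * T C tau) / (tau ^ 4 * T C tau)).

Definition zeta_integrand (C tau : R) : R :=
  sqrt C * Rpower tau (4 / 3) / ((-1 + C * tau ^ 2) * sqrt (T C tau)).

Lemma continuous_h_integrand C Cs tau :
  0 < tau -> 0 < T C tau -> 0 < 3 * tau ^ 2 - Cs ^ 2 * T C tau ->
  continuous (h_integrand C Cs) tau.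
Proof.
  intros Ht HT HD. apply @ex_derive_continuous.
  assert (0 < tau ^ 4) by (now apply pow_lt).
  assert (HTd : ex_derive (T C) tau)
    by (unfold T, Rpower; auto_derive; auto).
  unfold h_integrand. generalize dependent (T C); intros f HT HD HTd.
  auto_derive. repeat split; auto.
  - apply Rgt_not_eq. simpl in *. nra.
  - apply Rdiv_lt_0_compat; [|nra]. simpl in *. lra.
Qed.

Lemma continuous_zeta_integrand C tau :
  0 < tau -> 0 < T C tau -> 1 < C * tau ^ 2 ->
  continuous (zeta_integrand C) tau.
Proof.
  intros Ht HT HD. apply @ex_derive_continuous.
  assert (HTd : ex_derive (T C) tau)
    by (unfold T, Rpower; auto_derive; auto).
  unfold zeta_integrand, Rpower. generalize dependent (T C); intros f HT HTd.
  pose proof (sqrt_lt_R0 _ HT).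
  auto_derive. repeat split; auto.
  apply Rgt_not_eq, Rmult_lt_0_compat; simpl in *; lra.
Qed.

Lemma h_integrand_pullback C Cs x1 x2 u :
  admissible C Cs x1 x2 -> 0 < u < PI ->
  3 / 2 * ypath x1 x2 u * ((x2 - x1) / 2 * sin u)
    * h_integrand C Cs (xi_path x1 x2 u)
  = h_speed C Cs x1 x2 (xpath x1 x2 u).
Proof.
  intros [H1 H12 E1 E2 Hs] Hu. assert (H : 0 < x1 < x2) by lra.
  pose proof (ypath_pos x1 x2 u H) as Hy.
  pose proof (ypath_sqr x1 x2 u H) as Hy2.
  pose proof (sqrt_cofactor_pos x1 x2 u H) as Hq.
  destruct (sqrt_quartic C x1 x2 u H E1 E2 Hu) as [Hp Hsq].
  pose proof (momentum_sqr C x1 x2 u H E1 E2) as Hp2.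
  pose proof (xpath_bounds x1 x2 u H) as Hx.
  specialize (Hs (xpath x1 x2 u)).
  unfold h_integrand, h_speed. rewrite T_xi_path by auto.
  change (sqrt (xpath x1 x2 u)) with (ypath x1 x2 u).
  replace (3 * xi_path x1 x2 u ^ 2) with (3 * xpath x1 x2 u ^ 3)
    by (unfold xi_path; rewrite <- Hy2; ring).
  assert (HPp : 0 < quartic C (xpath x1 x2 u)) by (rewrite <- Hp2; now apply pow_lt).
  assert (Hxi : 0 < xi_path x1 x2 u) by (now apply pow_lt).
  rewrite sqrt_div_alt by (apply Rmult_lt_0_compat; auto; now apply pow_lt).
  rewrite sqrt_mult_alt by (left; now apply pow_lt).
  rewrite Hsq.
  replace (xi_path x1 x2 u ^ 4) with ((xi_path x1 x2 u ^ 2) ^ 2) by ring.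
  rewrite sqrt_pow2 by (apply pow2_ge_0).
  unfold xi_path, momentum in *.
  assert (Hsin : 0 < sin u) by (apply sin_gt_0; lra).
  field. repeat split; lra.
Qed.

Lemma zeta_integrand_pullback C Cs x1 x2 u :
  admissible C Cs x1 x2 -> 0 < u < PI ->
  3 / 2 * ypath x1 x2 u * ((x2 - x1) / 2 * sin u)
    * zeta_integrand C (xi_path x1 x2 u)
  = zeta_speed C x1 x2 (xpath x1 x2 u).
Proof.
  intros [H1 H12 E1 E2 Hs] Hu. assert (H : 0 < x1 < x2) by lra.
  pose proof (ypath_pos x1 x2 u H) as Hy.
  pose proof (ypath_sqr x1 x2 u H) as Hy2.
  pose proof (sqrt_cofactor_pos x1 x2 u H) as Hq.
  destruct (sqrt_quartic C x1 x2 u H E1 E2 Hu) as [Hp Hsq].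
  pose proof (xpath_bounds x1 x2 u H) as Hx.
  pose proof (C_cube_gt_1 C x1 x2 _ H E1 E2 Hx) as HC.
  unfold zeta_integrand, zeta_speed. rewrite T_xi_path by auto.
  rewrite Hsq.
  change (sqrt (xpath x1 x2 u)) with (ypath x1 x2 u).
  unfold xi_path. rewrite (Rpower_pow3 _ (4 / 3) 4) by (auto; simpl; field).
  replace (-1 + C * (ypath x1 x2 u ^ 3) ^ 2) with (C * xpath x1 x2 u ^ 3 - 1)
    by (rewrite <- Hy2; ring).
  assert (Hsin : 0 < sin u) by (apply sin_gt_0; lra).
  unfold momentum in *.
  field. repeat split; lra.
Qed.

(** The integrals start where the quartic is maximal, at [x = 9 C / 4]. *)
Definition u00 (C x1 x2 : R) : R := acos (((x1 + x2) / 2 - 9 / 4 * C) / ((x2 - x1) / 2)).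

Lemma xi_path_u00 C Cs x1 x2 :
  admissible C Cs x1 x2 ->
  0 < u00 C x1 x2 < PI /\ xi_path x1 x2 (u00 C x1 x2) = xi00 C.
Proof.
  intros [H1 H12 E1 E2 _]. assert (H : 0 < x1 < x2) by lra.
  pose proof (critical_point_between C x1 x2 H E1 E2) as Hc.
  set (r := ((x1 + x2) / 2 - 9 / 4 * C) / ((x2 - x1) / 2)).
  assert (Hr : -1 < r < 1).
  { unfold r. split; [apply Rlt_div_r | apply Rlt_div_l]; lra. }
  assert (Hcos : cos (u00 C x1 x2) = r) by (apply cos_acos; lra).
  split.
  - pose proof (acos_bound r) as B. fold (u00 C x1 x2) in B.
    change (acos r) with (u00 C x1 x2) in B.
    assert (u00 C x1 x2 <> 0) by (intros E; rewrite E, cos_0 in Hcos; lra).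
    assert (u00 C x1 x2 <> PI) by (intros E; rewrite E, cos_PI in Hcos; lra).
    lra.
  - assert (Hx : xpath x1 x2 (u00 C x1 x2) = 9 / 4 * C)
      by (unfold xpath; rewrite Hcos; unfold r; field; lra).
    unfold xi_path, ypath. rewrite Hx. unfold xi00.
    rewrite <- Rpower_sqrt by lra.
    rewrite <- Rpower_pow by (apply exp_pos). rewrite Rpower_mult.
    f_equal. simpl. field.
Qed.

Definition h_primitive (C Cs x1 x2 : R) : R -> R :=
  RInt (fun u => h_speed C Cs x1 x2 (xpath x1 x2 u)) (u00 C x1 x2).

Definition zeta_primitive (C x1 x2 : R) : R -> R :=
  RInt (fun u => zeta_speed C x1 x2 (xpath x1 x2 u)) (u00 C x1 x2).

Lemma is_derive_h_primitive C Cs x1 x2 u :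
  admissible C Cs x1 x2 ->
  is_derive (h_primitive C Cs x1 x2) u (h_speed C Cs x1 x2 (xpath x1 x2 u)).
Proof.
  intros A.
  apply (is_derive_primitive (fun u => h_speed C Cs x1 x2 (xpath x1 x2 u))).
  now apply (Cn_h_speed C Cs x1 x2 0).
Qed.

Lemma is_derive_zeta_primitive C Cs x1 x2 u :
  admissible C Cs x1 x2 ->
  is_derive (zeta_primitive C x1 x2) u (zeta_speed C x1 x2 (xpath x1 x2 u)).
Proof.
  intros A.
  apply (is_derive_primitive (fun u => zeta_speed C x1 x2 (xpath x1 x2 u))).
  now apply (Cn_zeta_speed C Cs x1 x2 0).
Qed.

Lemma xi_path_inside C Cs x1 x2 u :
  admissible C Cs x1 x2 -> 0 < u < PI ->
  0 < T C (xi_path x1 x2 u) /\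
  0 < 3 * xi_path x1 x2 u ^ 2 - Cs ^ 2 * T C (xi_path x1 x2 u) /\
  1 < C * xi_path x1 x2 u ^ 2.
Proof.
  intros [H1 H12 E1 E2 Hs] Hu. assert (H : 0 < x1 < x2) by lra.
  pose proof (xpath_bounds x1 x2 u H) as Hx.
  destruct (sqrt_quartic C x1 x2 u H E1 E2 Hu) as [Hp _].
  rewrite T_xi_path by auto.
  replace (xi_path x1 x2 u ^ 2) with (xpath x1 x2 u ^ 3)
    by (rewrite <- (ypath_sqr x1 x2 u H); unfold xi_path; ring).
  repeat split.
  - rewrite <- (momentum_sqr C x1 x2 u H E1 E2). now apply pow_lt.
  - apply Hs. lra.
  - now apply (C_cube_gt_1 C x1 x2).
Qed.

Lemma h0_xi_path C Cs x1 x2 u :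
  admissible C Cs x1 x2 -> 0 < u < PI ->
  h0 C Cs (xi_path x1 x2 u) = h_primitive C Cs x1 x2 u.
Proof.
  intros A Hu. pose proof A as [H1 H12 _ _ _]. assert (H : 0 < x1 < x2) by lra.
  destruct (xi_path_u00 C Cs x1 x2 A) as [H0 E0].
  unfold h0, h_primitive. rewrite <- E0.
  apply (RInt_by_substitution (h_integrand C Cs) (xi_path x1 x2)
    (fun u => 3 / 2 * ypath x1 x2 u * ((x2 - x1) / 2 * sin u)) _ 0 PI); auto.
  - intros v. now apply is_derive_xi_path.
  - now apply (Cn_xi_path_speed x1 x2 0).
  - intros v Hv. destruct (xi_path_inside C Cs x1 x2 v A Hv) as [? [? _]].
    apply continuous_h_integrand; auto. apply pow_lt. now apply ypath_pos.
  - intros v Hv. now apply h_integrand_pullback.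
Qed.

Lemma zeta0_xi_path C Cs x1 x2 u :
  admissible C Cs x1 x2 -> 0 < u < PI ->
  zeta0_int C (xi_path x1 x2 u) = zeta_primitive C x1 x2 u.
Proof.
  intros A Hu. pose proof A as [H1 H12 _ _ _]. assert (H : 0 < x1 < x2) by lra.
  destruct (xi_path_u00 C Cs x1 x2 A) as [H0 E0].
  unfold zeta0_int, zeta_primitive. rewrite <- E0.
  apply (RInt_by_substitution (zeta_integrand C) (xi_path x1 x2)
    (fun u => 3 / 2 * ypath x1 x2 u * ((x2 - x1) / 2 * sin u)) _ 0 PI); auto.
  - intros v. now apply is_derive_xi_path.
  - now apply (Cn_xi_path_speed x1 x2 0).
  - intros v Hv. destruct (xi_path_inside C Cs x1 x2 v A Hv) as [? [_ ?]].
    apply continuous_zeta_integrand; auto. apply pow_lt. now apply ypath_pos.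
  - intros v Hv. now apply (zeta_integrand_pullback C Cs).
Qed.

Lemma h0_limits C Cs x1 x2 :
  admissible C Cs x1 x2 ->
  h0_m1 C Cs (xi_path x1 x2 0) = h_primitive C Cs x1 x2 0 /\
  h0_p1 C Cs (xi_path x1 x2 PI) = h_primitive C Cs x1 x2 PI.
Proof.
  intros A. pose proof A as [H1 H12 _ _ _]. assert (H : 0 < x1 < x2) by lra.
  pose proof PI_RGT_0.
  assert (Hc : forall u, continuous (h_primitive C Cs x1 x2) u)
    by (intros; apply @ex_derive_continuous; eexists; now apply is_derive_h_primitive).
  split.
  - apply (lim_right_by_substitution _ _ (h_primitive C Cs x1 x2) 0 PI); auto.
    + now apply (Cn_xi_path x1 x2 0).
    + intros u Hu. now apply h0_xi_path.
    + intros u Hu. apply xi_path_increasing; auto; lra.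
  - apply (lim_left_by_substitution _ _ (h_primitive C Cs x1 x2) 0 PI); auto.
    + now apply (Cn_xi_path x1 x2 0).
    + intros u Hu. now apply h0_xi_path.
    + intros u Hu. apply xi_path_increasing; auto; lra.
Qed.

Lemma zeta0_limits C Cs x1 x2 :
  admissible C Cs x1 x2 ->
  zeta0_m1 C (xi_path x1 x2 0) = zeta_primitive C x1 x2 0 /\
  zeta0_p1 C (xi_path x1 x2 PI) = zeta_primitive C x1 x2 PI.
Proof.
  intros A. pose proof A as [H1 H12 _ _ _]. assert (H : 0 < x1 < x2) by lra.
  pose proof PI_RGT_0.
  assert (Hc : forall u, continuous (zeta_primitive C x1 x2) u)
    by (intros; apply @ex_derive_continuous; eexists;
        now apply (is_derive_zeta_primitive C Cs)).
  split.
  - apply (lim_right_by_substitution _ _ (zeta_primitive C x1 x2) 0 PI); auto.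
    + now apply (Cn_xi_path x1 x2 0).
    + intros u Hu. now apply (zeta0_xi_path C Cs).
    + intros u Hu. apply xi_path_increasing; auto; lra.
  - apply (lim_left_by_substitution _ _ (zeta_primitive C x1 x2) 0 PI); auto.
    + now apply (Cn_xi_path x1 x2 0).
    + intros u Hu. now apply (zeta0_xi_path C Cs).
    + intros u Hu. apply xi_path_increasing; auto; lra.
Qed.
(** * F and Phi in the parameter u *)

Lemma zigzag_0_or_PI k v :
  v = 0 \/ v = PI -> exists j, zigzag k v = IZR j * PI.
Proof.
  intros Hv. unfold zigzag. destruct (Z.even k); destruct Hv as [-> | ->].
  - exists k. ring.
  - exists (k + 1)%Z. rewrite plus_IZR. ring.
  - exists (k + 1)%Z. ring.
  - exists k. rewrite plus_IZR. ring.
Qed.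

Lemma zigzag_multiple j : zigzag j (if Z.even j then 0 else PI) = IZR j * PI.
Proof.
  unfold zigzag. destruct (Z.even j); [ring|]. rewrite plus_IZR. ring.
Qed.

Lemma primitive_multiple (P w : R -> R) j :
  (forall u, is_derive P u (w u)) ->
  (forall u u', cos u = cos u' -> w u = w u') ->
  P (IZR j * PI) = IZR j * (P PI - P 0) + P 0.
Proof.
  intros Hd Hw. rewrite <- zigzag_multiple, (primitive_zigzag P w) by auto.
  destruct (Z.even j); [ring|]. rewrite plus_IZR, minus_IZR. ring.
Qed.

Lemma xi_path_multiple x1 x2 j :
  xi_path x1 x2 (IZR j * PI) = xi_path x1 x2 (if Z.even j then 0 else PI).
Proof. now rewrite <- zigzag_multiple, xi_path_zigzag. Qed.

Lemma h_speed_cos C Cs x1 x2 u u' :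
  cos u = cos u' ->
  h_speed C Cs x1 x2 (xpath x1 x2 u) = h_speed C Cs x1 x2 (xpath x1 x2 u').
Proof. intros E. unfold xpath. now rewrite E. Qed.

Lemma zeta_speed_cos C x1 x2 u u' :
  cos u = cos u' ->
  zeta_speed C x1 x2 (xpath x1 x2 u) = zeta_speed C x1 x2 (xpath x1 x2 u').
Proof. intros E. unfold xpath. now rewrite E. Qed.

Lemma h_node_multiple C Cs x1 x2 k :
  admissible C Cs x1 x2 ->
  h_node C Cs (xi_path x1 x2 0) (xi_path x1 x2 PI) k =
  h_primitive C Cs x1 x2 (IZR (if (1 <=? k)%Z then k else k + 1) * PI).
Proof.
  intros A. destruct (h0_limits C Cs x1 x2 A) as [E1 E2].
  rewrite (primitive_multiple _ (fun u => h_speed C Cs x1 x2 (xpath x1 x2 u))).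
  - unfold h_node. rewrite E1, E2.
    destruct (1 <=? k)%Z; rewrite ?plus_IZR, ?minus_IZR; ring.
  - intros u. now apply is_derive_h_primitive.
  - apply h_speed_cos.
Qed.

Lemma h_branch_zigzag C Cs x1 x2 k v :
  admissible C Cs x1 x2 -> 0 < v < PI ->
  h_branch C Cs (xi_path x1 x2 0) (xi_path x1 x2 PI) k (xi_path x1 x2 v) =
  h_primitive C Cs x1 x2 (zigzag k v).
Proof.
  intros A Hv. destruct (h0_limits C Cs x1 x2 A) as [E1 E2].
  rewrite (primitive_zigzag _ (fun u => h_speed C Cs x1 x2 (xpath x1 x2 u))).
  - unfold h_branch. rewrite E1, E2, h0_xi_path by auto.
    destruct (Z.even k); ring.
  - intros u. now apply is_derive_h_primitive.
  - apply h_speed_cos.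
Qed.

Lemma xi_path_surj x1 x2 xi :
  0 < x1 < x2 -> xi_path x1 x2 0 < xi < xi_path x1 x2 PI ->
  exists v, 0 < v < PI /\ xi_path x1 x2 v = xi.
Proof.
  intros H Hxi. pose proof PI_RGT_0.
  destruct (IVT_gen (xi_path x1 x2) 0 PI xi) as [v [Hv E]].
  - intros u. apply continuity_pt_filterlim. now apply (Cn_xi_path x1 x2 0).
  - rewrite Rmin_left, Rmax_right; lra.
  - rewrite Rmin_left, Rmax_right in Hv by lra.
    exists v. split; auto.
    assert (v <> 0) by (intros ->; lra). assert (v <> PI) by (intros ->; lra). lra.
Qed.

Lemma F_node_multiple x1 x2 k :
  F_node (xi_path x1 x2 0) (xi_path x1 x2 PI) k =
  xi_path x1 x2 (IZR (if (1 <=? k)%Z then k else k + 1) * PI).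
Proof.
  rewrite xi_path_multiple. unfold F_node. destruct (1 <=? k)%Z.
  - now destruct (Z.even k).
  - replace (k + 1)%Z with (Z.succ k) by lia.
    rewrite Z.even_succ, <- Z.negb_even. now destruct (Z.even k).
Qed.

(** All branches and nodes lie on the single curve [(H u, xi_path u)]: the k-th
    branch is the part over the open interval from [k pi] to [(k+1) pi], and the
    nodes are the multiples of [pi]. *)
Lemma F_graph_iff C Cs x1 x2 h xi :
  admissible C Cs x1 x2 ->
  F_graph C Cs (xi_path x1 x2 0) (xi_path x1 x2 PI) h xi <->
  exists u, h = h_primitive C Cs x1 x2 u /\ xi = xi_path x1 x2 u.
Proof.
  intros A. pose proof A as [H1 H12 _ _ _]. assert (H : 0 < x1 < x2) by lra.
  split.
  - intros [[k [Hxi ->]] | [k [Hk [-> ->]]]].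
    + destruct (xi_path_surj x1 x2 xi H Hxi) as [v [Hv <-]].
      exists (zigzag k v). rewrite xi_path_zigzag. split; auto.
      now apply h_branch_zigzag.
    + exists (IZR (if (1 <=? k)%Z then k else k + 1) * PI). split.
      * now apply h_node_multiple.
      * apply F_node_multiple.
  - intros [u [-> ->]].
    destruct (zigzag_surj u) as [k [v [Hv ->]]].
    destruct (Req_dec v 0) as [E0 | N0]; [|destruct (Req_dec v PI) as [E1 | N1]].
    3: { left. exists k. rewrite xi_path_zigzag.
         assert (Hv' : 0 < v < PI) by lra.
         rewrite h_branch_zigzag by auto. repeat split; auto;
           apply xi_path_increasing; auto; lra. }
    all: right; destruct (zigzag_0_or_PI k v) as [j ->]; auto.
    all: exists (if (1 <=? j)%Z then j else j - 1)%Z.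
    all: rewrite h_node_multiple, F_node_multiple by auto.
    all: destruct (1 <=? j)%Z eqn:Hj.
    all: try (apply Z.leb_le in Hj; assert (Hj' : (1 <=? j)%Z = true)
           by (now apply Z.leb_le); rewrite Hj'; repeat split; auto; lia).
    all: apply Z.leb_gt in Hj; assert (Hj' : (1 <=? j - 1)%Z = false)
           by (apply Z.leb_gt; lia); rewrite Hj'.
    all: replace (j - 1 + 1)%Z with j by lia; repeat split; auto; lia.
Qed.

Lemma h_primitive_increasing C Cs x1 x2 u v :
  admissible C Cs x1 x2 ->
  h_primitive C Cs x1 x2 u <= h_primitive C Cs x1 x2 v -> u <= v.
Proof.
  intros A Hle. destruct (Rle_or_lt u v) as [|Hlt]; auto. exfalso.
  pose proof A as [H1 H12 _ _ _]. assert (H : 0 < x1 < x2) by lra.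
  destruct (MVT_cor2 (h_primitive C Cs x1 x2)
    (fun u => h_speed C Cs x1 x2 (xpath x1 x2 u)) v u Hlt) as [w [E _]].
  - intros w _. apply is_derive_Reals. now apply is_derive_h_primitive.
  - pose proof (xpath_bounds x1 x2 w H).
    assert (0 < h_speed C Cs x1 x2 (xpath x1 x2 w)) by (apply h_speed_pos; auto; lra).
    nra.
Qed.

Lemma F_h_primitive C Cs x1 x2 u :
  admissible C Cs x1 x2 ->
  F C Cs (xi_path x1 x2 0) (xi_path x1 x2 PI) (h_primitive C Cs x1 x2 u) =
  xi_path x1 x2 u.
Proof.
  intros A. apply (iota_unique (V := R_CompleteNormedModule)).
  - intros xi Hxi. apply (F_graph_iff C Cs x1 x2 _ _ A) in Hxi.
    destruct Hxi as [v [E ->]]. f_equal.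
    apply Rle_antisym; apply (h_primitive_increasing C Cs x1 x2); auto; lra.
  - apply F_graph_iff; auto. now exists u.
Qed.

Lemma in_piece_iff C Cs x1 x2 k u :
  admissible C Cs x1 x2 ->
  in_piece C Cs (xi_path x1 x2 0) (xi_path x1 x2 PI) k (h_primitive C Cs x1 x2 u)
  <-> exists v, 0 <= v <= PI /\ u = zigzag k v.
Proof.
  intros A. pose proof PI_RGT_0.
  assert (Hp : forall a b, a <= b -> h_primitive C Cs x1 x2 a <= h_primitive C Cs x1 x2 b).
  { intros a b Hab. apply Rnot_lt_le. intros Hlt.
    assert (b <= a) by (apply (h_primitive_increasing C Cs x1 x2); auto; lra).
    replace b with a in Hlt by lra. lra. }
  transitivity (IZR k * PI <= u <= IZR (k + 1) * PI).
  - (* The nodes skip the index 0: the node of index [k] is [H (k pi)] for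
       [k >= 1] and [H ((k+1) pi)] for [k <= -1]. *)
    transitivity (h_primitive C Cs x1 x2 (IZR k * PI) <= h_primitive C Cs x1 x2 u
      <= h_primitive C Cs x1 x2 (IZR (k + 1) * PI)).
    + unfold in_piece. rewrite !h_node_multiple by auto.
      destruct (Z.leb_spec 1 k); [|destruct (Z.eqb_spec k 0) as [->|]].
      * destruct (Z.leb_spec 1 (k + 1)); [reflexivity | lia].
      * reflexivity.
      * destruct (Z.leb_spec 1 (k - 1)); [lia|].
        replace (k - 1 + 1)%Z with k by lia. reflexivity.
    + split; intros [? ?]; split; auto; apply (h_primitive_increasing C Cs x1 x2); auto.
  - rewrite plus_IZR. unfold zigzag. destruct (Z.even k).
    + split; [intros; exists (u - IZR k * PI) | intros [v [? ->]]]; lra.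
    + rewrite plus_IZR.
      split; [intros; exists ((IZR k + 1) * PI - u) | intros [v [? ->]]]; lra.
Qed.

Lemma glue_h_primitive C Cs x1 x2 (f : Z -> R -> R) (y : R) u :
  admissible C Cs x1 x2 ->
  (forall k v, 0 <= v <= PI -> u = zigzag k v -> f k (xi_path x1 x2 v) = y) ->
  glue C Cs (xi_path x1 x2 0) (xi_path x1 x2 PI) f (h_primitive C Cs x1 x2 u) = y.
Proof.
  intros A Hf. apply (iota_unique (V := R_CompleteNormedModule)).
  - intros z [k [Hk ->]]. apply in_piece_iff in Hk; auto.
    destruct Hk as [v [Hv ->]]. rewrite F_h_primitive, xi_path_zigzag by auto. auto.
  - destruct (zigzag_surj u) as [k [v [Hv Hu]]].
    exists k. split.
    + apply in_piece_iff; auto. now exists v.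
    + rewrite F_h_primitive, Hu, xi_path_zigzag by auto. symmetry; auto.
Qed.

Lemma zeta0_closed C Cs x1 x2 v :
  admissible C Cs x1 x2 -> 0 <= v <= PI ->
  zeta0 C (xi_path x1 x2 0) (xi_path x1 x2 PI) (xi_path x1 x2 v) =
  zeta_primitive C x1 x2 v.
Proof.
  intros A Hv. pose proof A as [H1 H12 _ _ _]. assert (H : 0 < x1 < x2) by lra.
  destruct (zeta0_limits C Cs x1 x2 A) as [E1 E2].
  unfold zeta0. rewrite E1, E2.
  destruct (Req_EM_T (xi_path x1 x2 v) (xi_path x1 x2 0)) as [e | n].
  - destruct (Req_dec v 0) as [-> | N]; auto.
    pose proof (xi_path_increasing x1 x2 0 v H). lra.
  - destruct (Req_EM_T (xi_path x1 x2 v) (xi_path x1 x2 PI)) as [e' | n'].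
    + destruct (Req_dec v PI) as [-> | N]; auto.
      pose proof (xi_path_increasing x1 x2 v PI H). lra.
    + apply (zeta0_xi_path C Cs); auto.
      assert (v <> 0) by (intros ->; auto). assert (v <> PI) by (intros ->; auto). lra.
Qed.

Lemma sin_period_Z j v : sin (2 * IZR j * PI + v) = sin v.
Proof.
  rewrite <- (cos_shift v), <- (cos_shift (_ + v)).
  rewrite <- (cos_period_Z j (PI / 2 - (2 * IZR j * PI + v))). f_equal. ring.
Qed.

Lemma powerRZ_m1 k : powerRZ (-1) k = if Z.even k then 1 else -1.
Proof.
  revert k. apply (Z.peano_ind (fun k => powerRZ (-1) k = if Z.even k then 1 else -1)).
  - reflexivity.
  - intros k IH. unfold Z.succ. rewrite powerRZ_add, IH, powerRZ_1 by lra.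
    change (k + 1)%Z with (Z.succ k). rewrite Z.even_succ, <- Z.negb_even.
    destruct (Z.even k); simpl; ring.
  - intros k IH. unfold Z.pred. rewrite powerRZ_add, IH by lra.
    change (k + -1)%Z with (Z.pred k). rewrite Z.even_pred, <- Z.negb_even.
    destruct (Z.even k); simpl; field.
Qed.

(** The phase [zeta_0 + c_k] is [psi], up to the sign [(-1)^k] and a multiple
    of [2 pi], where [psi] is the primitive in [u]. *)
Lemma phase_zigzag C Cs x1 x2 c k v :
  admissible C Cs x1 x2 ->
  phase_constants C (xi_path x1 x2 0) (xi_path x1 x2 PI) c -> 0 <= v <= PI ->
  exists m, zeta0 C (xi_path x1 x2 0) (xi_path x1 x2 PI) (xi_path x1 x2 v) + c k =
    2 * IZR m * PI + powerRZ (-1) k * (zeta_primitive C x1 x2 (zigzag k v) + c 0%Z).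
Proof.
  intros A Hc Hv. destruct (zeta0_limits C Cs x1 x2 A) as [E1 E2].
  destruct (Hc k) as [m Hm]. rewrite E1, E2 in Hm.
  exists m. rewrite (zeta0_closed C Cs), Hm, powerRZ_m1 by auto.
  rewrite (primitive_zigzag _ (fun u => zeta_speed C x1 x2 (xpath x1 x2 u))).
  - destruct (Z.even k); ring.
  - intros u. now apply (is_derive_zeta_primitive C Cs).
  - apply zeta_speed_cos.
Qed.

Lemma Phi1_h_primitive C Cs x1 x2 c u :
  admissible C Cs x1 x2 ->
  phase_constants C (xi_path x1 x2 0) (xi_path x1 x2 PI) c ->
  Phi1 C Cs (xi_path x1 x2 0) (xi_path x1 x2 PI) c (h_primitive C Cs x1 x2 u) =
  sqrt (1 - 1 / (C * xi_path x1 x2 u ^ 2)) * cos (zeta_primitive C x1 x2 u + c 0%Z).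
Proof.
  intros A Hc. apply glue_h_primitive; auto.
  intros k v Hv ->. rewrite xi_path_zigzag. unfold Phi1_branch.
  destruct (phase_zigzag C Cs x1 x2 c k v A Hc Hv) as [m ->].
  rewrite cos_period_Z, powerRZ_m1. f_equal.
  destruct (Z.even k); [f_equal; ring|].
  rewrite <- cos_neg. f_equal. ring.
Qed.

Lemma Phi2_h_primitive C Cs x1 x2 c u :
  admissible C Cs x1 x2 ->
  phase_constants C (xi_path x1 x2 0) (xi_path x1 x2 PI) c ->
  Phi2 C Cs (xi_path x1 x2 0) (xi_path x1 x2 PI) c (h_primitive C Cs x1 x2 u) =
  sqrt (1 - 1 / (C * xi_path x1 x2 u ^ 2)) * sin (zeta_primitive C x1 x2 u + c 0%Z).
Proof.
  intros A Hc. apply glue_h_primitive; auto.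
  intros k v Hv ->. rewrite xi_path_zigzag. unfold Phi2_branch.
  destruct (phase_zigzag C Cs x1 x2 c k v A Hc Hv) as [m ->].
  rewrite sin_period_Z, powerRZ_m1.
  destruct (Z.even k).
  - rewrite !Rmult_1_l. reflexivity.
  - replace (-1 * (zeta_primitive C x1 x2 (zigzag k v) + c 0%Z))
      with (- (zeta_primitive C x1 x2 (zigzag k v) + c 0%Z)) by ring.
    rewrite sin_neg. ring.
Qed.

(** * The immersion in terms of the profile *)

Lemma admissible_of_roots C Cs xi01 xi02 :
  C > 4 / Rpower 3 (3 / 2) ->
  0 < Cs < Rpower (C - 4 / Rpower 3 (3 / 2)) (- (1 / 2)) ->
  0 < xi01 < xi02 -> T C xi01 = 0 -> T C xi02 = 0 ->
  exists x1 x2, admissible C Cs x1 x2 /\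
    xi01 = xi_path x1 x2 0 /\ xi02 = xi_path x1 x2 PI.
Proof.
  intros HC HCs [H1 H12] E1 E2.
  assert (Hcube : forall xi, 0 < xi -> (Rpower xi (/ 3)) ^ 3 = xi).
  { intros xi Hxi. rewrite <- Rpower_pow by (apply exp_pos).
    rewrite Rpower_mult. replace (/ 3 * INR 3) with 1 by (simpl; field).
    now apply Rpower_1. }
  assert (Hroot : forall xi, 0 < xi -> T C xi = 0 -> quartic C (Rpower xi (/ 3) ^ 2) = 0).
  { intros xi Hxi E. rewrite <- T_cube by (apply exp_pos). now rewrite Hcube. }
  assert (Hlt : Rpower xi01 (/ 3) < Rpower xi02 (/ 3)).
  { apply Rlt_Rpower_l; lra. }
  assert (P1 : 0 < Rpower xi01 (/ 3)) by (apply exp_pos).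
  exists (Rpower xi01 (/ 3) ^ 2), (Rpower xi02 (/ 3) ^ 2).
  split; [split|split].
  - now apply pow_lt.
  - nra.
  - now apply Hroot.
  - apply Hroot; auto; lra.
  - intros x. now apply metric_denominator_pos.
  - unfold xi_path, ypath, xpath. rewrite cos_0.
    replace (_ / 2 - _) with (Rpower xi01 (/ 3) ^ 2) by field.
    rewrite sqrt_pow2 by lra. symmetry. now apply Hcube.
  - unfold xi_path, ypath, xpath. rewrite cos_PI.
    replace (_ / 2 - _) with (Rpower xi02 (/ 3) ^ 2) by field.
    rewrite sqrt_pow2 by lra. symmetry. apply Hcube. lra.
Qed.

Definition inv_sqrt_D (Cs : R) (y p : R -> R) (h : R) : R :=
  / sqrt (3 * y h ^ 6 - Cs ^ 2 * p h ^ 2).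

(** The chain rule with [dU/dh = 1 / h_speed].  The factor [sqrt q] of
    [1 / h_speed] turns [sin u] into [momentum] in the first equation and
    cancels in the two others. *)
Lemma profile_of_inverse C Cs x1 x2 c0 U :
  0 < C -> admissible C Cs x1 x2 ->
  (forall h, is_derive U h (/ h_speed C Cs x1 x2 (xpath x1 x2 (U h)))) ->
  profile (sqrt C) (fun h => ypath x1 x2 (U h)) (fun h => momentum x1 x2 (U h))
    (fun h => zeta_primitive C x1 x2 (U h) + c0)
    (inv_sqrt_D Cs (fun h => ypath x1 x2 (U h)) (fun h => momentum x1 x2 (U h))).
Proof.
  intros HC A HU. pose proof A as [H1 H12 E1 E2 Hs].
  assert (H : 0 < x1 < x2) by lra.
  assert (HK : 0 < sqrt C) by (now apply sqrt_lt_R0).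
  assert (HK2 : sqrt C ^ 2 = C) by (apply pow2_sqrt; lra).
  set (D := fun u => sqrt (3 * xpath x1 x2 u ^ 3 - Cs ^ 2 * quartic C (xpath x1 x2 u))).
  assert (HD : forall u, 0 < D u).
  { intros u. apply sqrt_lt_R0, Hs. pose proof (xpath_bounds x1 x2 u H). lra. }
  assert (Hinv : forall h, inv_sqrt_D Cs (fun h => ypath x1 x2 (U h))
      (fun h => momentum x1 x2 (U h)) h = / D (U h)).
  { intros h. unfold inv_sqrt_D, D. rewrite (momentum_sqr C) by auto.
    do 2 f_equal. rewrite <- (ypath_sqr x1 x2 (U h) H). ring. }
  assert (Hspeed : forall u, h_speed C Cs x1 x2 (xpath x1 x2 u) =
    3 / 2 * D u / (ypath x1 x2 u ^ 5 * sqrt (cofactor x1 x2 (xpath x1 x2 u))))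
    by reflexivity.
  split; auto.
  - intros h. now apply ypath_pos.
  - intros h. rewrite Hinv. now apply Rinv_0_lt_compat.
  - intros h. rewrite HK2.
    pose proof (C_cube_gt_1 C x1 x2 _ H E1 E2 (xpath_bounds x1 x2 (U h) H)) as Hc.
    rewrite <- (ypath_sqr x1 x2 (U h) H) in Hc.
    replace (ypath x1 x2 (U h) ^ 6) with ((ypath x1 x2 (U h) ^ 2) ^ 3) by ring. lra.
  - intros h. rewrite (momentum_sqr C), HK2 by auto. unfold quartic.
    rewrite <- (ypath_sqr x1 x2 (U h) H). ring.
  - intros h. rewrite Hinv.
    pose proof (ypath_pos x1 x2 (U h) H). pose proof (sqrt_cofactor_pos x1 x2 (U h) H).
    specialize (HD (U h)).
    replace (_ / 3) with (/ h_speed C Cs x1 x2 (xpath x1 x2 (U h))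
      * ((x2 - x1) / 2 * sin (U h) / (2 * ypath x1 x2 (U h)))).
    + apply (is_derive_comp (ypath x1 x2) U); auto. now apply is_derive_ypath.
    + rewrite Hspeed. unfold momentum. field. lra.
  - intros h. rewrite Hinv, HK2.
    pose proof (ypath_pos x1 x2 (U h) H). pose proof (sqrt_cofactor_pos x1 x2 (U h) H).
    specialize (HD (U h)).
    replace (_ / 3) with (/ h_speed C Cs x1 x2 (xpath x1 x2 (U h))
      * ((9 * C * xpath x1 x2 (U h) ^ 2 - 4 * xpath x1 x2 (U h) ^ 3)
         / (2 * sqrt (cofactor x1 x2 (xpath x1 x2 (U h)))))).
    + apply (is_derive_comp (momentum x1 x2) U); auto. now apply is_derive_momentum.
    + rewrite Hspeed.
      generalize dependent (sqrt (cofactor x1 x2 (xpath x1 x2 (U h)))); intros q Hq.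
      rewrite <- (ypath_sqr x1 x2 (U h) H). field. lra.
  - intros h. rewrite Hinv, HK2.
    pose proof (ypath_pos x1 x2 (U h) H). pose proof (sqrt_cofactor_pos x1 x2 (U h) H).
    pose proof (C_cube_gt_1 C x1 x2 _ H E1 E2 (xpath_bounds x1 x2 (U h) H)) as Hc.
    specialize (HD (U h)).
    replace (sqrt C * _ * _ / _) with (/ h_speed C Cs x1 x2 (xpath x1 x2 (U h))
      * zeta_speed C x1 x2 (xpath x1 x2 (U h)) + 0).
    + apply (is_derive_plus (fun h => zeta_primitive C x1 x2 (U h)) (fun _ => c0)).
      * apply (is_derive_comp (zeta_primitive C x1 x2) U); auto.
        now apply (is_derive_zeta_primitive C Cs).
      * apply (is_derive_const (K := R_AbsRing) (V := R_NormedModule) c0).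
    + rewrite Hspeed. unfold zeta_speed.
      change (sqrt (xpath x1 x2 (U h))) with (ypath x1 x2 (U h)).
      generalize dependent (sqrt (cofactor x1 x2 (xpath x1 x2 (U h)))); intros q Hq.
      revert Hc. rewrite <- (ypath_sqr x1 x2 (U h) H). intros Hc.
      assert (0 < C * ypath x1 x2 (U h) ^ 6 - 1)
        by (replace (ypath x1 x2 (U h) ^ 6) with ((ypath x1 x2 (U h) ^ 2) ^ 3) by ring; lra).
      field. repeat split; try lra.
Qed.

Theorem theorem4p18 (C Cs xi01 xi02 : R) (c : Z -> R)
  (hC : C > 4 / Rpower 3 (3 / 2))
  (hCs : 0 < Cs < Rpower (C - 4 / Rpower 3 (3 / 2)) (- (1 / 2)))
  (hxi : 0 < xi01 < xi02)
  (hT1 : T C xi01 = 0)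
  (hT2 : T C xi02 = 0)
  (hc : phase_constants C xi01 xi02 c) :
  biconservative_immersion_S3 (metric_CCs C Cs xi01 xi02)
    (Phi_CCs C Cs xi01 xi02 c).
Proof.
  assert (HC : 0 < C).
  { apply Rlt_trans with (4 / Rpower 3 (3 / 2)); auto.
    apply Rdiv_lt_0_compat; [lra | apply exp_pos]. }
  destruct (admissible_of_roots C Cs xi01 xi02 hC hCs hxi hT1 hT2)
    as [x1 [x2 [A [-> ->]]]].
  pose proof A as [H1 H12 E1 E2 Hs]. assert (H : 0 < x1 < x2) by lra.
  destruct (h_speed_lower_bound C Cs x1 x2 A) as [m [Hm Hlow]].
  destruct (exists_inverse (h_primitive C Cs x1 x2) _ m Hm
    (fun u => is_derive_h_primitive C Cs x1 x2 u A) Hlow) as [U [_ [HU dU]]].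
  pose proof (profile_of_inverse C Cs x1 x2 (c 0%Z) U HC A dU) as Hprof.
  set (y := fun h => ypath x1 x2 (U h)) in *.
  set (p := fun h => momentum x1 x2 (U h)) in *.
  set (psi := fun h => zeta_primitive C x1 x2 (U h) + c 0%Z) in *.
  assert (Hy : forall h, 0 < y h) by apply Hprof.
  assert (HK : 0 < sqrt C) by (now apply sqrt_lt_R0).
  assert (HK2 : sqrt C ^ 2 = C) by (apply pow2_sqrt; lra).
  assert (HD : forall h, 0 < 3 * y h ^ 6 - Cs ^ 2 * p h ^ 2).
  { intros h. unfold p, y. rewrite (momentum_sqr C) by auto.
    replace (ypath x1 x2 (U h) ^ 6) with ((ypath x1 x2 (U h) ^ 2) ^ 3) by ring.
    rewrite ypath_sqr by auto. apply Hs. pose proof (xpath_bounds x1 x2 (U h) H). lra. }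
  assert (HF : forall h, F C Cs (xi_path x1 x2 0) (xi_path x1 x2 PI) h = y h ^ 3).
  { intros h. rewrite <- (HU h) at 1. now apply F_h_primitive. }
  assert (HT : forall h, T C (y h ^ 3) = p h ^ 2).
  { intros h. rewrite T_cube by auto. unfold y, p.
    now rewrite ypath_sqr, (momentum_sqr C) by auto. }
  assert (Hr : forall h, sqrt (1 - 1 / (C * xi_path x1 x2 (U h) ^ 2)) =
    rho (sqrt C) y h / (sqrt C * y h ^ 3)).
  { intros h. change (xi_path x1 x2 (U h)) with (y h ^ 3).
    specialize (Hy h). assert (Hy3 : 0 < y h ^ 3) by (now apply pow_lt).
    unfold rho. rewrite HK2.
    rewrite <- (sqrt_pow2 (sqrt C * y h ^ 3)) by (left; now apply Rmult_lt_0_compat).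
    rewrite <- sqrt_div_alt by (apply pow_lt; now apply Rmult_lt_0_compat).
    f_equal. rewrite Rpow_mult_distr, HK2. field. lra. }
  set (s := inv_sqrt_D Cs y p) in *.
  replace (metric_CCs C Cs (xi_path x1 x2 0) (xi_path x1 x2 PI))
    with (diag_field (metric_h y s) (metric_t y)).
  - replace (Phi_CCs C Cs (xi_path x1 x2 0) (xi_path x1 x2 PI) c)
      with (rotational (sqrt C) y psi).
    + apply (biconservative_rotational (sqrt C) y p psi s Hprof).
      intros n Cy Cp.
      apply Cn_inv.
      * intros h. apply Rgt_not_eq, sqrt_lt_R0, HD.
      * apply (Cn_sqrt n (fun h => 3 * y h ^ 6 - Cs ^ 2 * p h ^ 2)); auto.
        apply Cn_minus; apply Cn_scal; now apply Cn_pow.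
    + apply functional_extensionality; intros a.
      apply functional_extensionality; intros h.
      apply functional_extensionality; intros t.
      destruct a; simpl; unfold Phi3, Phi4; rewrite ?HF; auto.
      * rewrite <- (HU h), Phi1_h_primitive, Hr, HU by auto. reflexivity.
      * rewrite <- (HU h), Phi2_h_primitive, Hr, HU by auto. reflexivity.
  - apply functional_extensionality; intros i.
    apply functional_extensionality; intros j.
    apply functional_extensionality; intros h.
    apply functional_extensionality; intros t.
    destruct i, j; simpl; auto; rewrite HF.
    + rewrite HT. specialize (HD h). specialize (Hy h).
      unfold metric_h, s, inv_sqrt_D. rewrite pow_inv, pow2_sqrt by lra.
      field. replace ((y h ^ 3) ^ 2) with (y h ^ 6) by ring. lra.
    + specialize (Hy h). unfold metric_t. field. lra.
Qed.
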